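(* For each integer $n \le 60$, let $N(n)$ denote the number of isomorphism classes of semi-equivelar maps of type $\{4,6,12\}$ on the torus with exactly $n$ vertices. Then $N(36)=1$, $N(48)=2$, $N(60)=1$, and $N(n)=0$ for every other $n\le 60$.
   Context: A map on the torus is an embedding of a finite simple graph on the torus such that the closure of each connected component of the complement of the graph (a face) is a closed 2-cell; a face with $p$ vertices is a $p$-gon. A map is semi-equivelar of type $\{4,6,12\}$ if at every vertex $v$ exactly three faces are incident, namely one quadrilateral, one hexagon and one 12-gon. Two maps are isomorphic if there is a bijection between their vertex sets that maps the vertex sets of faces of one map exactly onto the vertex sets of faces of the other.
   Formalization: Maps are additionally required to be polyhedral (two distinct faces share nothing, a vertex or an edge); without this a 12-vertex map exists, so N(12)=0 fails. Embeddings on the torus are given as rotation systems with V-E+F=0. *)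

(* Defs.v *)
From mathcomp Require Import all_boot all_fingroup.

Set Implicit Arguments.
Unset Strict Implicit.
Unset Printing Implicit Defensive.

(* Embeddings of a connected graph in an oriented closed surface whose faces  *)
(* are open discs correspond to rotation systems on the graph                 *)
(* (Heffter-Edmonds).  A value of [rotation V] is the pair of an adjacency    *)
(* set and of a family of permutations, the one at v giving the cyclic order  *)
(* of the neighbours of v around v.                                           *)
Definition rotation (V : finType) : finType :=
  ({set V * V} * {ffun V -> {perm V}})%type.

Section Rotation.

Variables (V : finType) (M : rotation V).

(* An edge {x, y} is represented by its two darts (x, y) and (y, x). *)
Definition darts : {set V * V} := M.1.

Definition adj : rel V := [rel x y | (x, y) \in darts].

Definition rot_at (v : V) : {perm V} := M.2 v.

Definition neighbours (v : V) : {set V} := [set x | adj v x].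

Definition simple_graph : bool :=
  [forall x, ~~ adj x x] && [forall x, forall y, adj x y ==> adj y x].

Definition connected_graph : bool :=
  (0 < #|V|) && [forall x, forall y, connect adj x y].

(* The permutation at v fixes the non-neighbours of v and has the set of      *)
(* neighbours of v as a single cycle.                                         *)
Definition rotation_system : bool :=
  [forall v, perm_on (neighbours v) (rot_at v) &&
    [forall x in neighbours v, neighbours v == porbit (rot_at v) x]].

(* Face tracing: having walked from x to y, continue to the neighbour of y    *)
(* that follows x around y.  Each face is the set of darts of its boundary    *)
(* walk.                                                                      *)
Definition face_step (d : V * V) : V * V := (d.2, rot_at d.2 d.1).

Definition face_of (d : V * V) : {set V * V} :=
  [set d' | fconnect face_step d d'].

Definition faces : {set {set V * V}} := [set face_of d | d in darts].

Definition face_verts (F : {set V * V}) : {set V} := [set d.1 | d in F].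

(* The closure of an open disc face is a closed disc if and only if its       *)
(* boundary walk does not repeat a vertex.                                    *)
Definition closed_2cells : bool :=
  [forall F in faces, #|face_verts F| == #|F|].

(* V - E + F = 0; surfaces given by rotation systems are orientable, so that  *)
(* Euler characteristic 0 means that the surface is the torus.                *)
Definition euler_torus : bool := (#|V| + #|faces|).*2 == #|darts|.

(* The intersection of two distinct faces is empty, a vertex or an edge.      *)
(* This convention on maps cannot be dropped: the quotients of the plane      *)
(* tiling of type {4,6,12} by its lattice of translations, and by the         *)
(* sublattices of index 2, are embeddings of simple graphs on the torus with  *)
(* 12 and 24 vertices all of whose closed faces are discs.                    *)
Definition polyhedral : bool :=
  [forall F in faces, forall G in faces, (F != G) ==>
    ((#|face_verts F :&: face_verts G| <= 1) ||
     [exists d in F, ((d.2, d.1) \in G) &&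
        (face_verts F :&: face_verts G == [set d.1; d.2])])].

Definition torus_map : bool :=
  [&& simple_graph, connected_graph, rotation_system, closed_2cells,
      euler_torus & polyhedral].

Definition faces_at (v : V) : {set {set V * V}} :=
  [set F in faces | v \in face_verts F].

Definition ngons_at (p : nat) (v : V) : {set {set V * V}} :=
  [set F in faces_at v | #|face_verts F| == p].

Definition type_4_6_12 : bool :=
  [forall v, [&& #|faces_at v| == 3, #|ngons_at 4 v| == 1,
                 #|ngons_at 6 v| == 1 & #|ngons_at 12 v| == 1]].

Definition face_vertex_sets : {set {set V}} := [set face_verts F | F in faces].

End Rotation.

Definition map_iso (V : finType) : rel (rotation V) :=
  [rel M M' | [exists s : {perm V},
     [set s @: A | A : {set V} in face_vertex_sets M] == face_vertex_sets M']].

Definition maps_4_6_12 (V : finType) : {set rotation V} :=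
  [set M | torus_map M && type_4_6_12 M].

(* Isomorphism classes of maps with n vertices, counted on the vertex set     *)
(* 'I_n.                                                                      *)
Definition num_maps_4_6_12 (n : nat) : nat :=
  #|equivalence_partition (@map_iso 'I_n) (maps_4_6_12 'I_n)|.

(* Main.v *)
Require Import Defs.
From mathcomp Require Import all_boot all_fingroup.

(* A map of type {4,6,12} is cubic, and walking along an edge reverses the    *)
(* cyclic order 4, 6, 12 of the faces around a vertex.  So it amounts to      *)
(* three involutions a, b, c of its 2-coloured vertex set, generating a       *)
(* quotient of the Coxeter group of type [6,3].  The translations t_j, the    *)
(* conjugates of t_0 = c b (ab)^3 by the powers of ab, generate an abelian    *)
(* group T, and an element of the Coxeter group that fixes a vertex is a      *)
(* translation: it preserves colours, and each rotation is conjugate to one   *)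
(* about the centre of a face, which moves every vertex.  Hence a T-orbit has *)
(* n/12 <= 5 elements.  Since two faces meet in at most an edge, no t_j has a *)
(* fixed point; by the pigeonhole principle either t_0^2 = t_1^2 = 1 on an    *)
(* orbit, or t_j = t_(j+2), t_(j+1) = t_j^2 for some j and the orbit is       *)
(* cyclic of order 3, 4 or 5.  Each of these cases determines the map up to   *)
(* isomorphism, and the two cases with 48 vertices differ in whether the      *)
(* squares of the translations are trivial.                                   *)

(** The Coxeter group [6,3] acts simply transitively on the vertices of the plane tiling of type
    {4,6,12}, and a toroidal map of this type is the same thing as a transitive action of that group
    in which the faces keep their sizes and meet properly. [flag_system] states this for three
    involutions: [flag_systemM] reads it off a map, [flag_map_torus] and [flag_map_type] build a map
    from it, and [imset_polygons] and [polygons_iso_flag] compare bijections respecting the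
    involutions with isomorphisms of maps.

    For the upper bound the action is cut down to a single orbit of the translation lattice. By
    [flag_rot_differs] a rotation composed with a translation fixes no vertex, so the twelve
    elements [place e j] carry an orbit to twelve disjoint copies of itself ([place_inj]). Hence n
    is 12 times the size of an orbit, and the action of the six shortest translations on one orbit
    determines the whole map ([modelled_bij], [modelled_iso]). With at most five points in an orbit
    and no fixed points of short translations ([flag_translation_free]), [flag_classification]
    leaves only cyclic orbits, where the translations 0, 1, 2 act as t, t^2, t, and orbits of the
    Klein four-group.

    For the lower bound the maps are written down as tables and their flag systems checked by
    computation. The cyclic and the Klein map with 48 vertices are told apart by the square of a
    translation, which an isomorphism has to respect. *)

Set Implicit Arguments.
Unset Strict Implicit.
Unset Printing Implicit Defensive.

(** * Flag systems and the flags of a map *)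

(* The p-gon at x is walked along by [side a b c o p]: at a flag of colour    *)
(* [true] the sides of the quadrilateral, hexagon and 12-gon leave along c,   *)
(* a and b, at a flag of the other colour along b, c and a.                   *)
Definition side (V : Type) (a b c : V -> V) (o : pred V) (p : nat) (x : V) : V :=
  if p == 4 then if o x then c x else b x
  else if p == 6 then if o x then a x else c x
  else if o x then b x else a x.

Section FlagSystems.

Variable V : finType.

Definition cycle_set (f : V -> V) (x : V) : {set V} := [set y | fconnect f x y].

Lemma cycle_set_refl f x : x \in cycle_set f x.
Proof. by rewrite inE connect0. Qed.

Lemma cycle_set_iter f n x : iter n f x \in cycle_set f x.
Proof. by rewrite inE fconnect_iter. Qed.

Lemma cycle_set_eq f x y : injective f -> y \in cycle_set f x ->
  cycle_set f y = cycle_set f x.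
Proof.
move=> injf; rewrite inE => xy; apply/setP=> u; rewrite !inE.
by rewrite (same_connect (fconnect_sym injf) xy).
Qed.

Lemma eq_cycle_set f g : f =1 g -> cycle_set f =1 cycle_set g :> (V -> {set V}).
Proof. by move=> e x; apply/setP=> y; rewrite !inE (eq_fconnect e). Qed.

(* The involutions a, b, c move along the edge at a vertex that is not on     *)
(* its quadrilateral, hexagon, 12-gon respectively.                           *)
Record flag_system (a b c : V -> V) (o : pred V) : Prop := FlagSystem {
  flag_aK : involutive a;
  flag_bK : involutive b;
  flag_cK : involutive c;
  flag_oa : forall x, o (a x) = ~~ o x;
  flag_ob : forall x, o (b x) = ~~ o x;
  flag_oc : forall x, o (c x) = ~~ o x;
  flag_ind : forall (P : pred V) (x : V), P x ->
    (forall y, P y -> [&& P (a y), P (b y) & P (c y)]) -> forall y, P y;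
  flag_card : forall p x, p \in [:: 4; 6; 12] ->
    #|cycle_set (side a b c o p) x| = p;
  flag_cap46 : forall x,
    cycle_set (side a b c o 4) x :&: cycle_set (side a b c o 6) x = [set x; c x];
  flag_cap4_12 : forall x,
    cycle_set (side a b c o 4) x :&: cycle_set (side a b c o 12) x = [set x; b x];
  flag_cap6_12 : forall x,
    cycle_set (side a b c o 6) x :&: cycle_set (side a b c o 12) x = [set x; a x]
}.

Definition polygons (a b c : V -> V) (o : pred V) : {set {set V}} :=
  [set A | [exists x, has (fun p => A == cycle_set (side a b c o p) x)
                          [:: 4; 6; 12]]].

Lemma polygonsP a b c o A :
  reflect (exists p x, p \in [:: 4; 6; 12] /\ A = cycle_set (side a b c o p) x)
          (A \in polygons a b c o).
Proof.
rewrite inE; apply: (iffP existsP) => [[x /hasP[p pP /eqP->]]|[p [x [pP ->]]]].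
  by exists p, x.
by exists x; apply/hasP; exists p.
Qed.

End FlagSystems.

(** * The involutions and the colours of a map *)

Section MapFlags.

Variables (V : finType) (M : rotation V).
Hypotheses (torM : torus_map M) (typM : type_4_6_12 M).

Let simM : simple_graph M. Proof. by case/and5P: torM. Qed.
Let conM : connected_graph M. Proof. by case/and5P: torM. Qed.
Let rotM : rotation_system M. Proof. by case/and5P: torM. Qed.
Let celM : closed_2cells M. Proof. by case/and5P: torM. Qed.
Let polM : polyhedral M. Proof. by case/and5P: torM => _ _ _ _ /andP[]. Qed.

Local Notation D := (darts M).
Local Notation step := (face_step M).
Local Notation rot := (rot_at M).

Lemma adj_irrefl x : (x, x) \notin D.
Proof. by case/andP: simM => /forallP/(_ x). Qed.

Lemma adj_sym x y : (x, y) \in D -> (y, x) \in D.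
Proof. by case/andP: simM => _ /forallP/(_ x)/forallP/(_ y)/implyP. Qed.

Lemma rot_on v : perm_on (neighbours M v) (rot v).
Proof. by move/forallP/(_ v): rotM => /andP[]. Qed.

Lemma rot_porbit v x : (v, x) \in D -> neighbours M v = porbit (rot v) x.
Proof.
move=> vx; move/forallP/(_ v): rotM => /andP[_ /forallP/(_ x)/implyP h].
by apply/eqP/h; rewrite inE.
Qed.

Lemma rot_dart v x : ((v, rot v x) \in D) = ((v, x) \in D).
Proof. by have := perm_closed x (rot_on v); rewrite !inE. Qed.

Lemma step_inj : injective step.
Proof. by move=> [x y] [x' y'] [<-] /perm_inj ->. Qed.

Lemma step_dart d : d \in D -> step d \in D.
Proof. by case: d => x y /adj_sym xy; rewrite /face_step rot_dart. Qed.

Lemma face_of_step d : face_of M (step d) = face_of M d.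
Proof. by apply/setP=> d'; rewrite !inE -(same_fconnect1 step_inj). Qed.

Lemma face_of_refl d : d \in face_of M d.
Proof. by rewrite inE connect0. Qed.

Lemma face_of_eq d d' : d' \in face_of M d -> face_of M d' = face_of M d.
Proof.
rewrite inE => dd'; apply/setP=> e; rewrite !inE.
by rewrite (same_connect (fconnect_sym step_inj) dd').
Qed.

Lemma face_of_faces d : d \in D -> face_of M d \in faces M.
Proof. exact: imset_f. Qed.

Lemma face_of_darts d d' : d \in D -> d' \in face_of M d -> d' \in D.
Proof.
move=> dD; rewrite inE => /iter_findex <-.
by elim: (findex _ _ _) => //= n /step_dart.
Qed.

Lemma face_fst_inj d : d \in D -> {in face_of M d &, injective fst}.
Proof.
move=> dD; apply/imset_injP.
by move/forallP/(_ (face_of M d))/implyP: celM; apply; apply: face_of_faces.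
Qed.

Definition gon_size (d : V * V) := #|face_verts (face_of M d)|.

Lemma gon_size_step d : gon_size (step d) = gon_size d.
Proof. by rewrite /gon_size face_of_step. Qed.

Lemma fst_face_verts d : d.1 \in face_verts (face_of M d).
Proof. by apply/imsetP; exists d; rewrite ?face_of_refl. Qed.

Lemma ngons_at1 p v : p \in [:: 4; 6; 12] -> #|ngons_at M p v| = 1.
Proof.
move/forallP/(_ v): typM => /and4P[_ /eqP h4 /eqP h6 /eqP h12].
by rewrite !inE => /or3P[] /eqP ->.
Qed.

Lemma face_of_ngons v y : (v, y) \in D ->
  face_of M (v, y) \in ngons_at M (gon_size (v, y)) v.
Proof. by move=> vy; rewrite !inE face_of_faces // (fst_face_verts (v, y)) /=. Qed.

(** There is one p-gon at v, and its boundary walk visits v only once because its closure is a disc;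
    so at most one dart leaves v along it. *)
Lemma gon_size_inj v y y' : (v, y) \in D -> (v, y') \in D ->
  gon_size (v, y) \in [:: 4; 6; 12] -> gon_size (v, y) = gon_size (v, y') -> y = y'.
Proof.
move=> vy vy' hp epp.
have /eqP/cards1P[F eF] := ngons_at1 v hp.
have /set1P e1 : face_of M (v, y) \in [set F] by rewrite -eF face_of_ngons.
have /set1P e2 : face_of M (v, y') \in [set F] by rewrite -eF epp face_of_ngons.
have vy'F : (v, y') \in face_of M (v, y) by rewrite e1 -e2 face_of_refl.
by have [] := face_fst_inj vy (face_of_refl _) vy'F erefl.
Qed.

Lemma gon_size_ex p v : p \in [:: 4; 6; 12] ->
  exists2 y, (v, y) \in D & gon_size (v, y) = p.
Proof.
move=> hp; have /eqP/cards1P[F eF] := ngons_at1 v hp.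
have : F \in ngons_at M p v by rewrite eF set11.
rewrite !inE => /andP[/andP[/imsetP[d dD ->]]].
case/imsetP=> -[v' y] vy -> /eqP szp; exists y.
  exact: face_of_darts dD vy.
by rewrite /gon_size (face_of_eq vy).
Qed.

(** The vertex after v on the boundary walk of the p-gon at v. The default value v is not reached
    when p is 4, 6 or 12. *)
Definition gon_next (p : nat) (v : V) : V :=
  odflt v [pick y | ((v, y) \in D) && (gon_size (v, y) == p)].

Lemma gon_nextP p v : p \in [:: 4; 6; 12] ->
  (v, gon_next p v) \in D /\ gon_size (v, gon_next p v) = p.
Proof.
move=> hp; rewrite /gon_next; case: pickP => [y /andP[? /eqP]|h] //=.
by case: (gon_size_ex v hp) => y vy yp; have := h y; rewrite vy yp eqxx.
Qed.

Lemma gon_next_dart p v : p \in [:: 4; 6; 12] -> (v, gon_next p v) \in D.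
Proof. by case/(gon_nextP v). Qed.

Lemma gon_nextE p v y : p \in [:: 4; 6; 12] -> (v, y) \in D ->
  gon_size (v, y) = p -> gon_next p v = y.
Proof.
move=> hp vy yp; case: (gon_nextP v hp) => h1 h2.
by apply: gon_size_inj h1 vy _ _; rewrite h2.
Qed.

(** A face of another size would be a fourth face at v, besides the quadrilateral, the hexagon and
    the 12-gon. *)
Lemma gon_size_mem v y : (v, y) \in D -> gon_size (v, y) \in [:: 4; 6; 12].
Proof.
move=> vy; apply: contraT => hp.
pose F p := face_of M (v, gon_next p v).
have in_at z : (v, z) \in D -> face_of M (v, z) \in faces_at M v.
  by move=> vz; rewrite inE face_of_faces // (fst_face_verts (v, z)).
have szF p : p \in [:: 4; 6; 12] -> #|face_verts (F p)| = p.
  by case/(gon_nextP v).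
have us : uniq [:: face_of M (v, y); F 4; F 6; F 12].
  apply: (@map_uniq _ _ (fun G => #|face_verts G|)).
  by rewrite /= !szF // -[#|_|]/(gon_size (v, y)) hp.
have := uniq_leq_size us (s2 := enum (faces_at M v)).
rewrite -cardE; have /andP[/eqP-> _] := forallP typM v.
move=> h; suff /h: {subset [:: face_of M (v, y); F 4; F 6; F 12] <= enum (faces_at M v)} by [].
move=> G; rewrite mem_enum 4!in_cons in_nil orbF.
by case/or4P=> /eqP->; apply: in_at => //; apply: gon_next_dart.
Qed.

Lemma gon_nextEsize v y : (v, y) \in D -> gon_next (gon_size (v, y)) v = y.
Proof. by move=> vy; apply: gon_nextE => //; apply: gon_size_mem. Qed.

Lemma gon_next_inj v p q : p \in [:: 4; 6; 12] -> q \in [:: 4; 6; 12] ->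
  gon_next p v = gon_next q v -> p = q.
Proof.
by move=> /(gon_nextP v)[_ ep] /(gon_nextP v)[_ eq] e; rewrite -ep e eq.
Qed.

Lemma gon_next_next p v : p \in [:: 4; 6; 12] ->
  gon_next p (gon_next p v) = rot (gon_next p v) v.
Proof.
move=> hp; have [dp szp] := gon_nextP v hp.
apply: gon_nextE hp (step_dart dp) _.
by rewrite -[X in _ = X]szp -[RHS]gon_size_step.
Qed.

(** Face tracing continues the dart from [gon_next p v] back to v with the dart from v to
    [rot v (gon_next p v)], so that this backward dart lies on the q-gon. *)
Lemma rot_gon_next p q v : p \in [:: 4; 6; 12] -> q \in [:: 4; 6; 12] ->
  rot v (gon_next p v) = gon_next q v -> gon_next q (gon_next p v) = v.
Proof.
move=> hp hq e; have [dp _] := gon_nextP v hp; have [dq szq] := gon_nextP v hq.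
apply: gon_nextE hq (adj_sym dp) _.
by rewrite -gon_size_step /face_step /= e.
Qed.

Lemma neighboursE v :
  neighbours M v = [set gon_next 4 v; gon_next 6 v; gon_next 12 v].
Proof.
apply/setP=> y; rewrite in_setU in_set2 in_set1 inE /adj /=.
apply/idP/idP => [vy|].
  have e := gon_nextEsize vy; have := gon_size_mem vy; rewrite !inE.
  by case/or3P=> /eqP ep; rewrite -e ep eqxx ?orbT.
by case/orP=> [/orP[]|] /eqP->; apply: gon_next_dart.
Qed.

Lemma card_neighbours v : #|neighbours M v| = 3.
Proof.
rewrite neighboursE -setUA cardsU1 cards2 in_set2.
by do !case: eqP => [/gon_next_inj -/(_ isT isT) //|_].
Qed.

Lemma rot_neq v y : (v, y) \in D -> (rot v y != y) && (rot v (rot v y) != y).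
Proof.
move=> vy; have := uniq_traject_porbit (rot v) y.
rewrite -rot_porbit // card_neighbours /= !inE negb_or andbT.
by case/andP => /andP[h1 h2] _; rewrite ![_ == y]eq_sym h1 h2.
Qed.

Lemma rot_rot_rot v y : (v, y) \in D -> rot v (rot v (rot v y)) = y.
Proof.
by move=> vy; have := iter_porbit (rot v) y; rewrite -rot_porbit // card_neighbours.
Qed.

(** The colour is the orientation at v: the rotation runs through the sides of the 4-gon, 6-gon and
    12-gon in this order if it is [true], in the reverse order if it is [false]. *)
Definition flag_colour (v : V) : bool := rot v (gon_next 4 v) == gon_next 6 v.

Local Notation o := flag_colour.

Lemma rot_true v : o v ->
  [/\ rot v (gon_next 4 v) = gon_next 6 v, rot v (gon_next 6 v) = gon_next 12 v
    & rot v (gon_next 12 v) = gon_next 4 v].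
Proof.
move/eqP=> e46.
have [d4 _] := gon_nextP v (isT : 4 \in [:: 4; 6; 12]).
have [d6 _] := gon_nextP v (isT : 6 \in [:: 4; 6; 12]).
have e6 : rot v (gon_next 6 v) = gon_next 12 v.
  have : rot v (gon_next 6 v) \in neighbours M v by rewrite inE /adj /= rot_dart.
  rewrite neighboursE in_setU in_set2 in_set1 => /orP[/orP[]|] /eqP e //.
    by have := rot_neq d4; rewrite e46 e eqxx andbF.
  by have := rot_neq d6; rewrite e eqxx.
by split=> //; rewrite -e6 -e46 rot_rot_rot.
Qed.

Lemma rot_false v : o v = false ->
  [/\ rot v (gon_next 4 v) = gon_next 12 v, rot v (gon_next 12 v) = gon_next 6 v
    & rot v (gon_next 6 v) = gon_next 4 v].
Proof.
move/eqP=> ne46.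
have [d4 _] := gon_nextP v (isT : 4 \in [:: 4; 6; 12]).
have [d12 _] := gon_nextP v (isT : 12 \in [:: 4; 6; 12]).
have e4 : rot v (gon_next 4 v) = gon_next 12 v.
  have : rot v (gon_next 4 v) \in neighbours M v by rewrite inE /adj /= rot_dart.
  rewrite neighboursE in_setU in_set2 in_set1 => /orP[/orP[]|] /eqP e //.
  by have := rot_neq d4; rewrite e eqxx.
have e12 : rot v (gon_next 12 v) = gon_next 6 v.
  have : rot v (gon_next 12 v) \in neighbours M v by rewrite inE /adj /= rot_dart.
  rewrite neighboursE in_setU in_set2 in_set1 => /orP[/orP[]|] /eqP e //.
    by have := rot_neq d4; rewrite e4 e eqxx andbF.
  by have := rot_neq d12; rewrite e eqxx.
by split=> //; rewrite -e12 -e4 rot_rot_rot.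
Qed.

(* If p is followed by q around v then q is followed by p around the          *)
(* neighbour of v along the p-gon, so adjacent vertices have opposite         *)
(* colours.                                                                   *)
Lemma rot_back p q v : p \in [:: 4; 6; 12] -> q \in [:: 4; 6; 12] ->
  rot v (gon_next p v) = gon_next q v ->
  rot (gon_next p v) (gon_next q (gon_next p v)) = gon_next p (gon_next p v).
Proof. by move=> hp hq e; rewrite (rot_gon_next hp hq e) gon_next_next. Qed.

Lemma flag_colour_next p v : p \in [:: 4; 6; 12] -> o (gon_next p v) = ~~ o v.
Proof.
move=> hp; case ov: (o v); [have [e4 e6 e12] := rot_true ov|have [e4 e12 e6] := rot_false ov];
case ow: (o (gon_next p v)) => //;
[have [f4 f6 f12] := rot_true ow|have [f4 f12 f6] := rot_false ow];
move: hp ov ow f4 f6 f12; rewrite !inE => /or3P[] /eqP-> ov ow;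
by [ rewrite (rot_back _ _ e4) // => /gon_next_inj -/(_ isT isT)
   | rewrite (rot_back _ _ e6) // => _ /gon_next_inj -/(_ isT isT)
   | rewrite (rot_back _ _ e12) // => _ _ /gon_next_inj -/(_ isT isT)
   | rewrite (rot_back _ _ e4) // => _ /gon_next_inj -/(_ isT isT)
   | rewrite (rot_back _ _ e6) // => _ _ /gon_next_inj -/(_ isT isT)
   | rewrite (rot_back _ _ e12) // => /gon_next_inj -/(_ isT isT)
   | rewrite (rot_back _ _ e4) // => _ _ /gon_next_inj -/(_ isT isT)
   | rewrite (rot_back _ _ e6) // => /gon_next_inj -/(_ isT isT)
   | rewrite (rot_back _ _ e12) // => _ /gon_next_inj -/(_ isT isT)].
Qed.

Definition flag_a (v : V) : V := if o v then gon_next 6 v else gon_next 12 v.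
Definition flag_b (v : V) : V := if o v then gon_next 12 v else gon_next 4 v.
Definition flag_c (v : V) : V := if o v then gon_next 4 v else gon_next 6 v.

Local Notation a := flag_a.
Local Notation b := flag_b.
Local Notation c := flag_c.

Lemma side_gon_next p : p \in [:: 4; 6; 12] -> side a b c o p =1 gon_next p.
Proof.
by rewrite !inE => /or3P[] /eqP-> v; rewrite /side /= /flag_a /flag_b /flag_c;
  case: (o v).
Qed.

Lemma flag_a_involutive : involutive a.
Proof.
move=> v; rewrite {2}/flag_a; case ov: (o v); rewrite /flag_a flag_colour_next // ov /=.
  by apply: rot_gon_next => //; case: (rot_true ov).
by apply: rot_gon_next => //; case: (rot_false ov).
Qed.

Lemma flag_b_involutive : involutive b.
Proof.
move=> v; rewrite {2}/flag_b; case ov: (o v); rewrite /flag_b flag_colour_next // ov /=.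
  by apply: rot_gon_next => //; case: (rot_true ov).
by apply: rot_gon_next => //; case: (rot_false ov).
Qed.

Lemma flag_c_involutive : involutive c.
Proof.
move=> v; rewrite {2}/flag_c; case ov: (o v); rewrite /flag_c flag_colour_next // ov /=.
  by apply: rot_gon_next => //; case: (rot_true ov).
by apply: rot_gon_next => //; case: (rot_false ov).
Qed.

Lemma face_verts_gon p v : p \in [:: 4; 6; 12] ->
  face_verts (face_of M (v, gon_next p v)) = cycle_set (gon_next p) v.
Proof.
move=> hp.
have iterE n : iter n step (v, gon_next p v) =
    (iter n (gon_next p) v, gon_next p (iter n (gon_next p) v)).
  by elim: n => //= n ->; rewrite /face_step /= gon_next_next.
apply/setP=> y; apply/imsetP/idP => [[d]|].
  by rewrite inE => /iter_findex <- ->; rewrite iterE cycle_set_iter.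
rewrite inE => /iter_findex <-.
exists (iter (findex (gon_next p) v y) step (v, gon_next p v)).
  by rewrite inE fconnect_iter.
by rewrite iterE.
Qed.

(** Both faces contain the two vertices v and w, so [polyhedral] makes their intersection the set of
    ends of an edge, which has no room for a third vertex. *)
Lemma gon_next_cap p q v w : p \in [:: 4; 6; 12] -> q \in [:: 4; 6; 12] ->
  p != q -> w = gon_next p v -> gon_next q w = v ->
  cycle_set (gon_next p) v :&: cycle_set (gon_next q) v = [set v; w].
Proof.
move=> hp hq npq ew ev; have [dp szp] := gon_nextP v hp; have [dq szq] := gon_nextP v hq.
have vw : v != w by apply: contraTneq dp => e; rewrite -ew -e adj_irrefl.
pose I := cycle_set (gon_next p) v :&: cycle_set (gon_next q) v.
have vI : v \in I by rewrite inE !cycle_set_refl.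
have gq_inj : injective (gon_next q).
  move=> x y e.
  have [dx szx] := gon_nextP x hq; have [dy szy] := gon_nextP y hq.
  have := gon_next_next x hq; rewrite e gon_next_next // => /perm_inj -> //.
have wI : w \in I.
  rewrite inE {1}ew (cycle_set_iter _ 1) /= inE (fconnect_sym gq_inj).
  by rewrite -ev fconnect1.
have := forallP polM (face_of M (v, gon_next p v)).
rewrite face_of_faces //= => /forallP/(_ (face_of M (v, gon_next q v))).
rewrite face_of_faces //= => /implyP.
rewrite !face_verts_gon // -/I; case/(_ _)/orP.
- by apply: contra_neq npq => e; rewrite -szp -szq /gon_size e.
- rewrite leqNgt => /negP[]; apply: (@leq_trans #|[set v; w]|).
    by rewrite cards2 vw.
  by apply: subset_leq_card; apply/subsetP=> x /set2P[] ->.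
case/exists_inP=> d _ /andP[_ /eqP eI].
apply/esym/eqP; rewrite -/I eqEcard; apply/andP; split.
  by apply/subsetP=> x /set2P[] ->.
by rewrite eI !cards2 vw; case: eqP.
Qed.

Lemma flag_systemM : flag_system a b c o.
Proof.
split.
- exact: flag_a_involutive.
- exact: flag_b_involutive.
- exact: flag_c_involutive.
- by move=> x; rewrite /flag_a; case ox: (o x); rewrite flag_colour_next ?ox.
- by move=> x; rewrite /flag_b; case ox: (o x); rewrite flag_colour_next ?ox.
- by move=> x; rewrite /flag_c; case ox: (o x); rewrite flag_colour_next ?ox.
- move=> P x Px Pabc y.
  case/andP: conM => _ /forallP/(_ x)/forallP/(_ y)/connectP[s].
  elim: s x Px => [x Px _ ->|z s IHs x Px] //= /andP[xz]; apply: IHs.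
  have : z \in neighbours M x by rewrite inE.
  have /and3P[] := Pabc x Px; rewrite /flag_a /flag_b /flag_c neighboursE.
  rewrite in_setU in_set2 in_set1.
  by case: (o x) => h1 h2 h3 /orP[/orP[]|] /eqP->.
- move=> p x hp; rewrite (eq_cycle_set (side_gon_next hp)) -face_verts_gon //.
  by case: (gon_nextP x hp).
- move=> x; rewrite !(eq_cycle_set (side_gon_next _)) //.
  have := flag_c_involutive x; rewrite {1}/flag_c; rewrite /flag_c.
  case ox: (o x); rewrite flag_colour_next // ox /= => e.
    exact: gon_next_cap.
  by rewrite setIC; apply: gon_next_cap.
- move=> x; rewrite !(eq_cycle_set (side_gon_next _)) //.
  have := flag_b_involutive x; rewrite {1}/flag_b; rewrite /flag_b.
  case ox: (o x); rewrite flag_colour_next // ox /= => e.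
    by rewrite setIC; apply: gon_next_cap.
  exact: gon_next_cap.
- move=> x; rewrite !(eq_cycle_set (side_gon_next _)) //.
  have := flag_a_involutive x; rewrite {1}/flag_a; rewrite /flag_a.
  case ox: (o x); rewrite flag_colour_next // ox /= => e.
    exact: gon_next_cap.
  by rewrite setIC; apply: gon_next_cap.
Qed.

Lemma polygonsM : polygons a b c o = face_vertex_sets M.
Proof.
apply/setP=> A; apply/polygonsP/imsetP => [[p [x [hp ->]]]|[F /imsetP[[v y] vy ->] ->]].
  rewrite (eq_cycle_set (side_gon_next hp)) -face_verts_gon //.
  exists (face_of M (x, gon_next p x)) => //.
  by apply: face_of_faces; case: (gon_nextP x hp).
have hp := gon_size_mem vy; exists (gon_size (v, y)), v; split=> //.
by rewrite (eq_cycle_set (side_gon_next hp)) -face_verts_gon // gon_nextEsize.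
Qed.

End MapFlags.

(** * The map of a flag system *)

Section FlagSides.

Variables (V : finType) (a b c : V -> V) (o : pred V).
Hypothesis fs : flag_system a b c o.

Let aK := flag_aK fs.
Let bK := flag_bK fs.
Let cK := flag_cK fs.
Let oa := flag_oa fs.
Let ob := flag_ob fs.
Let oc := flag_oc fs.

Local Notation sd := (side a b c o).

Lemma side_colour p x : o (sd p x) = ~~ o x.
Proof. by rewrite /side; do !case: ifP; rewrite ?oa ?ob ?oc // => ->. Qed.

Lemma side_inj p : injective (sd p).
Proof.
move=> x y e; have := congr1 o e; rewrite !side_colour => /negb_inj eo.
move: e; rewrite /side eo; case: (p == 4); last case: (p == 6); case: (o y) => /=.
- by move/(inv_inj cK).
- by move/(inv_inj bK).
- by move/(inv_inj aK).
- by move/(inv_inj cK).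
- by move/(inv_inj bK).
- by move/(inv_inj aK).
Qed.

Lemma side_side_neq p x : p \in [:: 4; 6; 12] -> sd p (sd p x) != x.
Proof.
move=> hp; apply/eqP=> e.
have fc : fcycle (sd p) [:: x; sd p x] by rewrite /= e !eqxx.
have : #|cycle_set (sd p) x| <= size [:: x; sd p x].
  apply: leq_trans (card_size _); apply: subset_leq_card; apply/subsetP=> y.
  by rewrite inE (fconnect_cycle fc (mem_head _ _)).
by rewrite (flag_card fs) //; move: hp; rewrite !inE => /or3P[] /eqP->.
Qed.

Lemma flag_ab_neq x : a x != b x.
Proof.
have := side_side_neq x (isT : 12 \in [:: 4; 6; 12]).
rewrite /side /=; case ox: (o x); rewrite ?oa ?ob ox /=.
  by apply: contra_neq => <-.
by apply: contra_neq => ->.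
Qed.

Lemma flag_ac_neq x : a x != c x.
Proof.
have := side_side_neq x (isT : 6 \in [:: 4; 6; 12]).
rewrite /side /=; case ox: (o x); rewrite ?oa ?oc ox /=.
  by apply: contra_neq => ->.
by apply: contra_neq => <-.
Qed.

Lemma flag_bc_neq x : b x != c x.
Proof.
have := side_side_neq x (isT : 4 \in [:: 4; 6; 12]).
rewrite /side /=; case ox: (o x); rewrite ?ob ?oc ox /=.
  by apply: contra_neq => <-.
by apply: contra_neq => ->.
Qed.

End FlagSides.

Section FlagMap.

Variables (V : finType) (a b c : V -> V) (o : pred V).
Hypothesis fs : flag_system a b c o.

Let aK := flag_aK fs.
Let bK := flag_bK fs.
Let cK := flag_cK fs.
Let oa := flag_oa fs.
Let ob := flag_ob fs.
Let oc := flag_oc fs.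

Local Notation sd := (side a b c o).

(** The two products of transpositions are the 3-cycles c, a, b and b, a, c of neighbours. They list
    the sides of the 4-gon, 6-gon and 12-gon in this order at colour [true] and in the reverse order
    at the other colour. *)
Definition flag_map : rotation V :=
  ([set d | d.2 \in [:: a d.1; b d.1; c d.1]],
   [ffun x => if o x then (tperm (c x) (a x) * tperm (c x) (b x))%g
              else (tperm (b x) (a x) * tperm (b x) (c x))%g]).

Local Notation M := flag_map.
Local Notation rot := (rot_at M).
Local Notation step := (face_step M).

Lemma flag_map_dart x y : ((x, y) \in darts M) = (y \in [:: a x; b x; c x]).
Proof. by rewrite inE. Qed.

Lemma flag_map_dartP x y :
  reflect (exists2 p, p \in [:: 4; 6; 12] & y = sd p x) ((x, y) \in darts M).
Proof.
rewrite flag_map_dart !inE; apply: (iffP or3P) => [h|[p]]; last first.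
  rewrite !inE => /or3P[] /eqP-> ->; rewrite /side /=;
  by case: (o x); rewrite eqxx; constructor.
case ox: (o x); case: h => /eqP->.
- by exists 6; rewrite /side ?ox.
- by exists 12; rewrite /side ?ox.
- by exists 4; rewrite /side ?ox.
- by exists 12; rewrite /side ?ox.
- by exists 4; rewrite /side ?ox.
- by exists 6; rewrite /side ?ox.
Qed.

Lemma tperm_cycle3 (u v w : V) : u != v -> u != w -> v != w ->
  [/\ (tperm u v * tperm u w)%g u = v, (tperm u v * tperm u w)%g v = w
    & (tperm u v * tperm u w)%g w = u].
Proof.
move=> uv uw vw; split; rewrite permM.
- by rewrite tpermL tpermD // eq_sym.
- by rewrite tpermR tpermL.
- by rewrite [tperm u v w]tpermD // tpermR.
Qed.

Lemma flag_rot_true x : o x ->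
  [/\ rot x (c x) = a x, rot x (a x) = b x & rot x (b x) = c x].
Proof.
move=> ox; rewrite /rot_at /= ffunE ox; apply: tperm_cycle3.
- by rewrite eq_sym (flag_ac_neq fs).
- by rewrite eq_sym (flag_bc_neq fs).
- exact: flag_ab_neq fs _.
Qed.

Lemma flag_rot_false x : o x = false ->
  [/\ rot x (b x) = a x, rot x (a x) = c x & rot x (c x) = b x].
Proof.
move=> ox; rewrite /rot_at /= ffunE ox; apply: tperm_cycle3.
- by rewrite eq_sym (flag_ab_neq fs).
- exact: flag_bc_neq fs _.
- exact: flag_ac_neq fs _.
Qed.

(** The involution that leads from x to y = [sd p x] also leads back, so x is a named neighbour of
    y, and the 3-cycle at y sends it to the next side of the p-gon. *)
Lemma flag_step p x : p \in [:: 4; 6; 12] ->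
  step (x, sd p x) = (sd p x, sd p (sd p x)).
Proof.
move=> hp; rewrite /face_step /=; congr (_, _); move: hp (side_colour fs p x).
rewrite !inE => /or3P[] /eqP->; case ox: (o x) => oy;
  rewrite [RHS]/side oy /= {2}/side /= ox.
- by rewrite -{2}(cK x); case: (flag_rot_false oy); rewrite /side /= ox.
- by rewrite -{2}(bK x); case: (flag_rot_true oy); rewrite /side /= ox.
- by rewrite -{2}(aK x); case: (flag_rot_false oy); rewrite /side /= ox.
- by rewrite -{2}(cK x); case: (flag_rot_true oy); rewrite /side /= ox.
- by rewrite -{2}(bK x); case: (flag_rot_false oy); rewrite /side /= ox.
- by rewrite -{2}(aK x); case: (flag_rot_true oy); rewrite /side /= ox.
Qed.

Lemma flag_face_of p x : p \in [:: 4; 6; 12] ->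
  face_of M (x, sd p x) = [set (y, sd p y) | y in cycle_set (sd p) x].
Proof.
move=> hp.
have iterE n : iter n step (x, sd p x) = (iter n (sd p) x, sd p (iter n (sd p) x)).
  by elim: n => //= n ->; rewrite flag_step.
apply/setP=> d; apply/idP/imsetP => [|[y]]; rewrite inE.
  move/iter_findex <-; exists (iter (findex step (x, sd p x) d) (sd p) x) => //.
  exact: cycle_set_iter.
by move/iter_findex <- => ->; rewrite inE -iterE fconnect_iter.
Qed.

Lemma flag_face_verts p x : p \in [:: 4; 6; 12] ->
  face_verts (face_of M (x, sd p x)) = cycle_set (sd p) x.
Proof.
move=> hp; rewrite flag_face_of // /face_verts -imset_comp.
by rewrite (eq_imset (g := id)) // imset_id.
Qed.

Lemma flag_card_face p x : p \in [:: 4; 6; 12] ->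
  #|face_of M (x, sd p x)| = p.
Proof.
move=> hp; rewrite flag_face_of // card_imset ?(flag_card fs) //.
by move=> y z [].
Qed.

Lemma flag_facesP F :
  reflect (exists p x, p \in [:: 4; 6; 12] /\ F = face_of M (x, sd p x))
          (F \in faces M).
Proof.
apply: (iffP imsetP) => [[[x y] /flag_map_dartP[p hp ->] ->]|[p [x [hp ->]]]].
  by exists p, x.
by exists (x, sd p x) => //; apply/flag_map_dartP; exists p.
Qed.

Lemma flag_face_at p x v : p \in [:: 4; 6; 12] ->
  v \in face_verts (face_of M (x, sd p x)) ->
  face_of M (x, sd p x) = face_of M (v, sd p v).
Proof.
move=> hp; rewrite flag_face_verts // => xv.
by rewrite !flag_face_of // (cycle_set_eq (@side_inj _ _ _ _ _ fs p) xv).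
Qed.

Local Notation Fc v p := (face_of M (v, sd p v)).

Lemma flag_faces_at v : faces_at M v = [set Fc v 4; Fc v 6; Fc v 12].
Proof.
apply/setP=> F; rewrite in_setU in_set2 in_set1 inE; apply/andP/idP.
  case=> /flag_facesP[p [x [hp ->]]] /(flag_face_at hp) ->.
  by move: hp; rewrite !inE => /or3P[] /eqP->; rewrite eqxx ?orbT.
have h p : p \in [:: 4; 6; 12] -> Fc v p \in faces M /\ v \in face_verts (Fc v p).
  move=> hp; split; first by apply/flag_facesP; exists p, v.
  by rewrite flag_face_verts // cycle_set_refl.
by case/orP=> [/orP[]|] /eqP->; apply: h.
Qed.

Lemma flag_card_face_verts p x : p \in [:: 4; 6; 12] -> #|face_verts (Fc x p)| = p.
Proof. by move=> hp; rewrite flag_face_verts // (flag_card fs). Qed.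

Lemma flag_face_neq v p q : p \in [:: 4; 6; 12] -> q \in [:: 4; 6; 12] ->
  p != q -> Fc v p != Fc v q.
Proof.
move=> hp hq; apply: contra_neq => e.
by rewrite -(flag_card_face v hp) e flag_card_face.
Qed.

Lemma flag_map_type : type_4_6_12 M.
Proof.
apply/forallP=> v.
have h p : p \in [:: 4; 6; 12] -> #|ngons_at M p v| == 1.
  move=> hp; apply/cards1P; exists (Fc v p).
  apply/setP=> F; rewrite /ngons_at in_set flag_faces_at in_setU in_set2 !in_set1.
  apply/andP/eqP => [[h /eqP]|->].
    case/orP: h => [/orP[]|] /eqP->; by rewrite flag_card_face_verts // => <-.
  rewrite flag_card_face_verts //; split=> //.
  by move: hp; rewrite !inE => /or3P[] /eqP->; rewrite eqxx ?orbT.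
rewrite !h // !andbT flag_faces_at -setUA cardsU1 cards2 in_set2.
by rewrite negb_or !flag_face_neq.
Qed.

Lemma flag_map_simple : simple_graph M.
Proof.
apply/andP; split; apply/forallP=> x.
  apply/flag_map_dartP=> -[p _ e]; have := side_colour fs p x.
  by rewrite -e; case: (o x).
apply/forallP=> y; apply/implyP; rewrite /adj /= !flag_map_dart !inE.
by case/or3P=> /eqP->; rewrite ?aK ?bK ?cK eqxx ?orbT.
Qed.

Lemma flag_map_neighbours v : neighbours M v = [set a v; b v; c v].
Proof.
by apply/setP=> y; rewrite in_setU in_set2 in_set1 inE /adj /= flag_map_dart
  !inE orbA.
Qed.

Lemma flag_map_rotation : rotation_system M.
Proof.
apply/forallP=> v; have perm_nb : perm_on (neighbours M v) (rot v).
  apply/subsetP=> y; rewrite inE flag_map_neighbours; apply: contraR.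
  rewrite in_setU in_set2 in_set1 !negb_or => /andP[/andP[ya yb] yc].
  by rewrite /rot_at ffunE; case: ifP => _; rewrite permM !tpermD // eq_sym.
rewrite perm_nb; apply/forall_inP=> x xv; apply/eqP/setP=> y; apply/idP/idP.
  suff eq3 : neighbours M v = [set x; rot v x; rot v (rot v x)].
    rewrite eq3 in_setU in_set2 in_set1 => /orP[/orP[]|] /eqP->.
    - exact: porbit_id.
    - by rewrite (mem_porbit _ 1).
    - by have := mem_porbit (rot v) 2 x; rewrite expgS expg1 permM.
  rewrite flag_map_neighbours; move: xv.
  rewrite flag_map_neighbours in_setU in_set2 in_set1.
  case ov: (o v); [have [ec ea eb] := flag_rot_true ov
                  |have [eb ea ec] := flag_rot_false ov];
  case/orP=> [/orP[]|] /eqP->; move: {perm_nb}(rot v) ea eb ec => R ea eb ec;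
  rewrite ?ea ?eb ?ec ?ea ?eb; apply/setP=> z; rewrite !in_setU !in_set1;
  by case: (z == a v); case: (z == b v); case: (z == c v).
case/porbitP=> i ->; elim: i => [|i IHi]; first by rewrite perm1.
by rewrite expgSr permM perm_closed.
Qed.

Lemma flag_map_cells : closed_2cells M.
Proof.
apply/forall_inP=> F /flag_facesP[p [x [hp ->]]].
by rewrite flag_card_face // flag_card_face_verts.
Qed.

Lemma flag_map_connected : 0 < #|V| -> connected_graph M.
Proof.
move=> V0; rewrite /connected_graph V0; apply/forallP=> x; apply/forallP.
apply: (flag_ind fs (x := x)) => [|y xy]; first exact: connect0.
by apply/and3P; split; apply: connect_trans xy _; apply: connect1;
  rewrite /adj /= flag_map_dart !inE eqxx ?orbT.
Qed.

(* Each vertex contributes 12/p to the sum over its p-gons, 3 + 2 + 1 in all. *)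
Lemma flag_map_euler : euler_torus M.
Proof.
have cardD : #|darts M| = 3 * #|V|.
  rewrite -sum1_card (partition_big fst xpredT) //= mulnC -sum_nat_const.
  apply: eq_bigr => v _; rewrite sum1dep_card.
  transitivity #|[set (v, y) | y in neighbours M v]|.
    apply: eq_card => -[x y]; rewrite inE; apply/andP/imsetP => [[xy /eqP <-]|[z]].
      by exists y; rewrite ?inE.
    by rewrite inE => vz [-> ->].
  rewrite card_imset => [|y z []] //.
  rewrite flag_map_neighbours -setUA cardsU1 cards2 in_set2.
  by rewrite negb_or (flag_ab_neq fs) (flag_ac_neq fs) (flag_bc_neq fs).
have cardF : 12 * #|faces M| = 6 * #|V|.
  rewrite mulnC -sum_nat_const [RHS]mulnC -sum_nat_const.
  transitivity (\sum_(F in faces M) \sum_(v in face_verts F) 12 %/ #|face_verts F|).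
    apply: eq_bigr => F /flag_facesP[p [x [hp ->]]].
    rewrite sum_nat_const flag_card_face_verts //.
    by move: hp; rewrite !inE => /or3P[] /eqP->.
  rewrite (exchange_big_dep xpredT) //=; apply: eq_bigr => v _.
  rewrite (eq_bigl (mem (faces_at M v))) => [|F]; last by rewrite !inE.
  rewrite flag_faces_at -setUA big_setU1 ?in_set2 ?negb_or ?flag_face_neq //=.
  rewrite big_setU1 ?in_set1 ?flag_face_neq //= big_set1 !flag_card_face_verts //.
rewrite /euler_torus cardD -(eqn_pmul2l (isT : 0 < 6)) doubleD mulnDr.
rewrite -(mul2n #|faces M|) [6 * (2 * _)]mulnA cardF -mul2n !mulnA -mulnDl.
by [].
Qed.

(** The boundary walks of the two faces traverse their common edge in opposite directions; which of
    them goes from v to w depends on the colour of v. *)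
Lemma flag_map_cap p q v : p \in [:: 4; 6; 12] -> q \in [:: 4; 6; 12] -> p != q ->
  exists w, [/\ cycle_set (sd p) v :&: cycle_set (sd q) v = [set v; w]
    & (w = sd p v /\ v = sd q w) \/ (w = sd q v /\ v = sd p w)].
Proof.
have key p' q' w : cycle_set (sd p') v :&: cycle_set (sd q') v = [set v; w] ->
    (w = sd p' v /\ v = sd q' w) \/ (w = sd q' v /\ v = sd p' w) ->
    exists w, [/\ cycle_set (sd q') v :&: cycle_set (sd p') v = [set v; w]
    & (w = sd q' v /\ v = sd p' w) \/ (w = sd p' v /\ v = sd q' w)].
  by move=> e h; exists w; rewrite setIC; split=> //; case: h; [right|left].
have k46 : (c v = sd 4 v /\ v = sd 6 (c v)) \/ (c v = sd 6 v /\ v = sd 4 (c v)).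
  by rewrite /side /= oc cK; case: (o v); [left|right].
have k4_12 : (b v = sd 4 v /\ v = sd 12 (b v)) \/ (b v = sd 12 v /\ v = sd 4 (b v)).
  by rewrite /side /= ob bK; case: (o v); [right|left].
have k6_12 : (a v = sd 6 v /\ v = sd 12 (a v)) \/ (a v = sd 12 v /\ v = sd 6 (a v)).
  by rewrite /side /= oa aK; case: (o v); [left|right].
have c46 := flag_cap46 fs v; have c4_12 := flag_cap4_12 fs v.
have c6_12 := flag_cap6_12 fs v.
rewrite !inE => /or3P[] /eqP-> /or3P[] /eqP-> // _.
- by exists (c v).
- by exists (b v).
- exact: key c46 k46.
- by exists (a v).
- exact: key c4_12 k4_12.
- exact: key c6_12 k6_12.
Qed.

Lemma flag_map_polyhedral : polyhedral M.
Proof.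
apply/forall_inP=> F /flag_facesP[p [x [hp ->]]].
apply/forall_inP=> G /flag_facesP[q [y [hq ->]]]; apply/implyP=> nFG.
have [->|[v]] := set_0Vmem (face_verts (Fc x p) :&: face_verts (Fc y q)).
  by rewrite cards0.
case/setIP=> /(flag_face_at hp) exv /(flag_face_at hq) eyv.
rewrite exv eyv in nFG *.
have npq : p != q by apply: contra_neq nFG => ->.
have [w [ew hw]] := flag_map_cap v hp hq npq; apply/orP; right.
rewrite !flag_face_verts // ew; apply/exists_inP.
have mem r u z : r \in [:: 4; 6; 12] -> u \in cycle_set (sd r) v -> z = sd r u ->
    (u, z) \in Fc v r.
  by move=> hr uv ->; rewrite flag_face_of //; apply: imset_f.
have /setIP[wp wq] : w \in cycle_set (sd p) v :&: cycle_set (sd q) v.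
  by rewrite ew set22.
case: hw => -[e1 e2].
  exists (v, w) => /=; first by apply: mem; rewrite ?cycle_set_refl.
  by rewrite mem //= eqxx.
exists (w, v) => /=; first exact: mem.
by rewrite mem ?cycle_set_refl //= setUC.
Qed.

Lemma flag_map_torus : 0 < #|V| -> torus_map M.
Proof.
move=> V0; apply/and5P; split.
- exact: flag_map_simple.
- exact: flag_map_connected.
- exact: flag_map_rotation.
- exact: flag_map_cells.
- by rewrite flag_map_euler flag_map_polyhedral.
Qed.

Lemma flag_map_polygons : face_vertex_sets M = polygons a b c o.
Proof.
apply/setP=> A; apply/imsetP/polygonsP => [[F /flag_facesP[p [x [hp ->]]] ->]|].
  by exists p, x; rewrite flag_face_verts.
case=> p [x [hp ->]]; exists (Fc x p); last by rewrite flag_face_verts.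
by apply/flag_facesP; exists p, x.
Qed.

End FlagMap.

(** * Translations in the Coxeter group [6,3] *)

(** The products [b * c], [a * c] and [a * b] are turns about the centre of a quadrilateral, a
    hexagon and a 12-gon, by a half, a third and a sixth of a full turn. *)
Definition coxeter_relations (gT : finGroupType) (a b c : gT) : Prop :=
  [/\ a * a = 1, b * b = 1 & c * c = 1]%g /\
  [/\ (b * c) ^+ 2 = 1, (a * c) ^+ 3 = 1 & (a * b) ^+ 6 = 1]%g.

Section Translations.

Local Open Scope group_scope.

Variables (gT : finGroupType) (a b c : gT).

Hypothesis cox : coxeter_relations a b c.

Let a2 : a * a = 1. Proof. by case: cox => -[]. Qed.
Let b2 : b * b = 1. Proof. by case: cox => -[]. Qed.
Let c2 : c * c = 1. Proof. by case: cox => -[]. Qed.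
Let bc2 : (b * c) ^+ 2 = 1. Proof. by case: cox => _ []. Qed.
Let ac3 : (a * c) ^+ 3 = 1. Proof. by case: cox => _ []. Qed.
Let ab6 : (a * b) ^+ 6 = 1. Proof. by case: cox => _ []. Qed.

Local Notation r := (a * b).

(** A product of two half-turns, [c * b] about the centre of a quadrilateral and [r ^+ 3] about that
    of a 12-gon, is a translation. Conjugation by the sixfold rotation r yields the six shortest
    translations, in cyclic order of direction. The lock prevents unfolding by conversion. *)
Definition translation : nat -> gT := locked (fun j => (c * b * r ^+ 3) ^ (r ^+ j)).

Lemma translationE j : translation j = (c * b * r ^+ 3) ^ (r ^+ j).
Proof. by rewrite /translation -lock. Qed.

Definition translations : {group gT} := (<[translation 0]> <*> <[translation 1]>)%G.

Local Notation tr := translation.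
Local Notation T := translations.

Let aV : a^-1 = a. Proof. by apply/eqP; rewrite eq_invg_mul a2. Qed.
Let bV : b^-1 = b. Proof. by apply/eqP; rewrite eq_invg_mul b2. Qed.
Let cV : c^-1 = c. Proof. by apply/eqP; rewrite eq_invg_mul c2. Qed.
Let aaK x : x * a * a = x. Proof. by rewrite -mulgA a2 mulg1. Qed.
Let bbK x : x * b * b = x. Proof. by rewrite -mulgA b2 mulg1. Qed.
Let ccK x : x * c * c = x. Proof. by rewrite -mulgA c2 mulg1. Qed.

Lemma rotV : r^-1 = b * a. Proof. by rewrite invMg aV bV. Qed.

Lemma rot_expV j : (r ^+ j)^-1 = r ^+ (5 * j).
Proof.
apply/eqP; rewrite eq_invg_mul -expgD.
by rewrite (_ : j + 5 * j = 6 * j)%N ?expgM ?ab6 ?expg1n.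
Qed.

Lemma rotV5 : r^-1 = r ^+ 5. Proof. exact: rot_expV 1%N. Qed.

Lemma rot_exp_mod j : r ^+ (j %% 6) = r ^+ j.
Proof. exact: expg_mod. Qed.

(** The reflection a inverts r, and [5 * j] stands for -j modulo 6, which avoids negative
    exponents. *)
Lemma rot_ref j : r ^+ j * a = a * r ^+ (5 * j).
Proof.
have ra : a * r * a = r^-1 by rewrite rotV mulgA a2 mul1g.
apply: (mulgI a); rewrite !mulgA a2 mul1g -rot_expV -expgVn -ra.
elim: j => [|j IHj]; first by rewrite !expg0 mulg1 a2.
by rewrite !expgS -IHj !mulgA aaK.
Qed.

Lemma bcC : b * c = c * b.
Proof.
have /eqP : b * c * (b * c) = 1 := bc2.
by rewrite -eq_invg_mul invMg bV cV => /eqP.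
Qed.

Lemma aca : a * c * a = c * a * c.
Proof.
have /eqP : a * c * (a * c * (a * c)) = 1 := ac3.
by rewrite -!mulgA mulgA mulgA [c * _]mulgA -eq_invg_mul !invMg aV cV mulgA => /eqP<-.
Qed.

Lemma rot3E : r ^+ 3 = b * a * b * a * b * a.
Proof.
have /eqP : r ^+ 3 * r ^+ 3 = 1 by rewrite -expgD.
rewrite -eq_invg_mul -expgVn rotV => /eqP <-.
by rewrite -[LHS]/(b * a * (b * a * (b * a))) !mulgA.
Qed.

Lemma rot3V : (r ^+ 3)^-1 = r ^+ 3.
Proof. by apply/eqP; rewrite eq_invg_mul -expgD ab6. Qed.

Lemma translation0 : tr 0 = c * a * b * a * b * a.
Proof. by rewrite translationE conjg1 rot3E !mulgA bbK. Qed.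

Lemma translation0E : tr 0 = c * b * r ^+ 3.
Proof. by rewrite translationE conjg1. Qed.

Lemma translationD i j : tr (i + j) = tr i ^ (r ^+ j).
Proof. by rewrite !translationE expgD conjgM. Qed.

Lemma translation_mod j : tr (j %% 6) = tr j.
Proof. by rewrite !translationE rot_exp_mod. Qed.

Lemma translation3 j : tr (j + 3) = (tr j)^-1.
Proof.
rewrite addnC -{2}(add0n j) !translationD -conjVg; congr (_ ^ _).
rewrite !translationE conjg1; have := rot3V; move: (r ^+ 3) => z zV.
rewrite conjgE !invMg zV bV cV bcC -!mulgA; do 2!congr (_ * _).
by rewrite -{1}zV mulVg mulg1.
Qed.

Lemma translation_b : tr 0 ^ b = tr 0.
Proof.
have rb : (r ^+ 3) ^ b = r ^+ 3.
  by rewrite conjXg conjgE bV !mulgA bbK -rotV expgVn rot3V.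
rewrite translationE conjg1; move: (r ^+ 3) rb => z rb.
by rewrite !conjMg rb !conjgE bV -bcC !mulgA bbK b2 mul1g bcC.
Qed.

Lemma translation_a j : tr j ^ a = tr (5 + 5 * j).
Proof.
rewrite translationD -[in LHS](add0n j) translationD -conjgM rot_ref conjgM.
congr (_ ^ _); rewrite -{1}translation_b -conjgM -rotV.
by rewrite -[5]/(0 + 5)%N translationD -rotV5.
Qed.

Lemma translation1 : tr 1 = b * a * c * a * b * a.
Proof.
by rewrite -[1%N]/(0 + 1)%N translationD translation0 conjgE rotV !mulgA aaK bbK.
Qed.

Lemma translation5 : tr 5 = a * c * a * b * a * b.
Proof.
rewrite -[5]/(0 + 5)%N translationD -rotV5 translationE conjg1 conjgE invgK.
have -> : c * b * r ^+ 3 * r^-1 = c * b * (r * r).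
  by rewrite -[r ^+ 3]/(r * (r * r)) rotV !mulgA bbK aaK.
by rewrite -bcC !mulgA bbK -[_ * c * a * b]mulgA.
Qed.

(** In the hexagonal lattice a shortest vector is the sum of the two at 60 degrees from it. As words
    this comes down to [aca] and [bcC]. *)
Lemma translation_split j : tr (j + 5) * tr (j + 1) = tr j.
Proof.
rewrite ![(j + _)%N]addnC -{3}(add0n j) !translationD -conjMg; congr (_ ^ _).
rewrite translation5 translation1 translation0 !mulgA bbK aaK.
by rewrite -(mulgA _ b c) bcC !mulgA aca ccK.
Qed.

(** The splitting at j + 1 gives one order of the factors and the splitting at j the other, whence
    the commutation of translations. *)
Lemma translation_succ j : tr (j + 1) = tr j * tr (j + 2) /\ tr (j + 1) = tr (j + 2) * tr j.
Proof.
have e5 i : tr (i + 5) = (tr (i + 2))^-1 by rewrite -translation3 -addnA.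
have e6 i : tr (i + 6) = tr i by rewrite -translation_mod modnDr translation_mod.
split.
  by rewrite -[in LHS](translation_split (j + 1)) -!addnA e6.
by rewrite -[in RHS](translation_split j) e5 mulKVg.
Qed.

Lemma translationS j : tr (j + 1) = tr j * tr (j + 2).
Proof. by case: (translation_succ j). Qed.

Lemma translation_comm j : commute (tr j) (tr (j + 2)).
Proof. by case: (translation_succ j) => e; rewrite e. Qed.

Lemma translation_comm01 : commute (tr 0) (tr 1).
Proof.
rewrite (translationS 0); apply: commuteM => //; exact: translation_comm 0%N.
Qed.

Lemma translation2 : tr 2 = (tr 0)^-1 * tr 1.
Proof. by rewrite (translationS 0) mulKg. Qed.

Lemma translation_cent : <[tr 1]> \subset 'C(<[tr 0]>).
Proof. exact/cents_cycle/commute_sym/translation_comm01. Qed.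

Lemma translationsP g :
  reflect (exists i j, g = tr 0 ^+ i * tr 1 ^+ j) (g \in translations).
Proof.
rewrite /= cent_joinEr ?translation_cent //.
apply: (iffP mulsgP) => [[x y]|[i [j ->]]].
  by case/cycleP=> i -> /cycleP[j ->] ->; exists i, j.
by exists (tr 0 ^+ i) (tr 1 ^+ j); rewrite ?mem_cycle.
Qed.

Lemma translations_abelian : abelian translations.
Proof. by rewrite abelianY !cycle_abelian translation_cent. Qed.

Lemma translationsC g h : g \in translations -> h \in translations ->
  commute g h.
Proof. by move=> g_T h_T; apply: (centsP translations_abelian). Qed.

Lemma translation_in j : tr j \in translations.
Proof.
have h0 : tr 0 \in translations by apply: (subsetP (joing_subl _ _)); apply: cycle_id.
have h1 : tr 1 \in translations by apply: (subsetP (joing_subr _ _)); apply: cycle_id.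
have h2 : tr 2 \in translations by rewrite translation2 groupM ?groupV.
rewrite -translation_mod; have := ltn_pmod j (isT : 0 < 6).
case: (j %% 6) => [|[|[|[|[|[|]]]]]] // _.
- by rewrite (translation3 0) groupV.
- by rewrite (translation3 1) groupV.
- by rewrite (translation3 2) groupV.
Qed.

Lemma translations_conj_r k g : g \in translations -> g ^ (r ^+ k) \in translations.
Proof.
case/translationsP=> i [j ->]; rewrite conjMg !conjXg -!translationD.
by rewrite groupM ?groupX ?translation_in.
Qed.

Lemma translations_conj_a g : g \in translations -> g ^ a \in translations.
Proof.
case/translationsP=> i [j ->]; rewrite conjMg !conjXg !translation_a.
by rewrite groupM ?groupX ?translation_in.
Qed.


End Translations.

(** * Rotations composed with translations fix no vertex *)

Section Rigidity.

Local Open Scope group_scope.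

Variables (V : finType) (a b c : {perm V}).

Hypothesis cox : coxeter_relations a b c.

Let a2 : a * a = 1. Proof. by case: cox => -[]. Qed.
Let b2 : b * b = 1. Proof. by case: cox => -[]. Qed.
Let c2 : c * c = 1. Proof. by case: cox => -[]. Qed.
Let bc2 : (b * c) ^+ 2 = 1. Proof. by case: cox => _ []. Qed.
Let ac3 : (a * c) ^+ 3 = 1. Proof. by case: cox => _ []. Qed.
Let ab6 : (a * b) ^+ 6 = 1. Proof. by case: cox => _ []. Qed.

Local Notation r := (a * b).
Local Notation tr := (translation a b c).
Local Notation T := (translations a b c).

Hypothesis bc_free : forall x, (b * c) x != x.
Hypothesis ac_free : forall x, (a * c) x != x.
Hypothesis r_free : forall k x, 0 < k < 4 -> (r ^+ k) x != x.

Let TC := translationsC cox.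
Let trT := translation_in cox.
Let trV := translation3 cox.

(** Equivalently, the rotation [r ^+ k * g^-1] has no fixed point. *)
Definition rot_differs k (g : {perm V}) := forall x, (r ^+ k) x != g x.

(** Conjugating the rotation by the translation s multiplies g by [s * (s ^ (r ^+ k))^-1]. So only
    the class of g modulo such elements matters, and each class needs just one rotation known to be
    free. *)
Lemma rot_differs_shift k s g : s \in T -> g \in T ->
  rot_differs k (g * (s * (s ^ (r ^+ k))^-1)) -> rot_differs k g.
Proof.
move=> sT gT h x; apply/eqP=> e; have /eqP[] := h (s^-1 x).
have e' : s^-1 * r ^+ k = r ^+ k * (s ^ (r ^+ k))^-1.
  by rewrite conjgE !invMg invgK !mulgA mulgV mul1g.
have sT' := translations_conj_r cox k sT.
rewrite -permM e' permM e -!permM; congr (fun_of_perm _ _).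
by rewrite !mulgA (TC (groupVr sT) gT) mulgKV.
Qed.

Lemma rot_differs_tr k j g : g \in T ->
  rot_differs k (g * (tr j * (tr (j + k))^-1)) -> rot_differs k g.
Proof. by move=> gT; rewrite translationD; apply: rot_differs_shift. Qed.

Lemma rot_differs_cycle k h g : h \in T -> g \in T ->
  (forall g, g \in T -> rot_differs k (g * h) -> rot_differs k g) ->
  forall g', g' \in <[h]> -> rot_differs k (g * g') -> rot_differs k g.
Proof.
move=> hT gT sh g' /cycleP[i ->]; elim: i g gT => [|i IHi] g gT.
  by rewrite mulg1.
by rewrite expgS mulgA => /(IHi _ (groupM gT hT)); apply: sh.
Qed.


(** For k = 1 the shifts generate T: every turn by a sixth is conjugate to r. *)
Lemma rot_differs1 g : g \in T -> rot_differs 1 g.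
Proof.
have P1 : rot_differs 1 1 by move=> x; rewrite perm1 r_free.
have sh0 g' : g' \in T -> rot_differs 1 (g' * tr 0) -> rot_differs 1 g'.
  move=> gT h; apply: (rot_differs_tr (j := 1) gT).
  by rewrite (translationS cox 0) mulgK.
have sh01 g' : g' \in T -> rot_differs 1 (g' * (tr 0 * (tr 1)^-1)) -> rot_differs 1 g'.
  by move=> gT; apply: (rot_differs_tr (j := 0) gT).
have P0 i : rot_differs 1 (tr 0 ^+ i).
  have cVi : (tr 0 ^+ i)^-1 \in <[tr 0]> by rewrite groupV mem_cycle.
  apply: (rot_differs_cycle _ _ sh0 cVi); rewrite ?groupX ?trT //.
  by rewrite mulgV.
case/(translationsP cox)=> i [j ->].
have hT : tr 0 * (tr 1)^-1 \in T by rewrite groupM ?groupV ?trT.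
have gT : tr 0 ^+ i * tr 1 ^+ j \in T by rewrite groupM ?groupX ?trT.
apply: (rot_differs_cycle hT gT sh01 (mem_cycle _ j)).
rewrite expgMn; last by apply: TC; rewrite ?groupV trT.
rewrite -mulgA [tr 0 ^+ j * _]TC ?groupX ?groupV ?trT //.
by rewrite expgVn mulKVg -expgD.
Qed.

(** For k = 2 the shifts leave the classes of 1, [tr 0] and its inverse. The first is a turn about a
    12-gon, the other two are conjugate to [c * a] or its inverse, turns about a hexagon. *)
Lemma rot_differs2 g : g \in T -> rot_differs 2 g.
Proof.
have P0 : rot_differs 2 1 by move=> x; rewrite perm1 r_free.
have t0E : tr 0 * r ^- 2 = b * (c * a) * b.
  by rewrite translation0E -mulgA (expgS r 2) mulgK -(bcC cox) !mulgA.
have t0E' : tr 0 * r ^+ 2 = c * a.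
  rewrite translation0E -mulgA -expgD -(rotV5 cox) (rotV cox) !mulgA.
  by rewrite -(mulgA c) b2 mulg1.
have P1 : rot_differs 2 (tr 0).
  move=> x; apply/eqP=> e; have : (tr 0 * r ^- 2) x = x by rewrite permM -e permK.
  rewrite t0E !permM => e'.
  have bK u : b (b u) = u by rewrite -permM b2 perm1.
  have aK u : a (a u) = u by rewrite -permM a2 perm1.
  have cK u : c (c u) = u by rewrite -permM c2 perm1.
  have e2 : a (c (b x)) = b x by rewrite -{2}e' bK.
  by have /eqP[] := ac_free (b x); rewrite permM -{1}e2 aK cK.
have P1' : rot_differs 2 (tr 0)^-1.
  move=> x; apply/eqP=> e; have : (tr 0 * r ^+ 2) ((r ^+ 2) x) = (r ^+ 2) x.
    by rewrite permM e permKV -e.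
  rewrite t0E'; move: ((r ^+ 2) x) => y; rewrite permM => ey.
  have aK u : a (a u) = u by rewrite -permM a2 perm1.
  have cK u : c (c u) = u by rewrite -permM c2 perm1.
  by have /eqP[] := ac_free y; rewrite permM -{1}ey aK cK.
have sh3 g' : g' \in T -> rot_differs 2 (g' * ((tr 0)^-1 * tr 2)) -> rot_differs 2 g'.
  move=> gT h; apply: (rot_differs_tr (j := 3) gT).
  by rewrite (trV 2) (trV 0) invgK.
have sh4 g' : g' \in T -> rot_differs 2 (g' * ((tr 1)^-1 * (tr 0)^-1)) -> rot_differs 2 g'.
  move=> gT h; apply: (rot_differs_tr (j := 4) gT).
  by rewrite (trV 1) -(translation_mod cox (4 + 2)).
have P0m m : rot_differs 2 (tr 0 ^+ m).
  (* Since [tr 2] is [(tr 0)^-1 * tr 1], the shifts [sh3] and [sh4] together multiply by the inverse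
     cube of [tr 0]. *)
  have sub3 n : rot_differs 2 (tr 0 ^+ n) -> rot_differs 2 (tr 0 ^+ (n + 3)).
    move=> h; have gT : tr 0 ^+ (n + 3) \in T by rewrite groupX ?trT.
    apply: (sh3 _ gT); apply: sh4; first by rewrite !groupM ?groupV ?trT.
    by rewrite (translation2 cox) !mulgA mulgK addn3 !expgSr !mulgK.
  have base : [/\ rot_differs 2 (tr 0 ^+ m), rot_differs 2 (tr 0 ^+ m.+1)
      & rot_differs 2 (tr 0 ^+ m.+2)].
    elim: m => [|m [h0 h1 h2]]; last by split=> //; rewrite -(addn3 m); apply: sub3.
    split=> //; rewrite ?expg0 ?expg1 //.
    apply: sh3; rewrite ?groupX ?trT //; apply: sh4; rewrite ?groupM ?groupV ?groupX ?trT //.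
    by rewrite (translation2 cox) !mulgA mulgK !expgSr !mulgK expg0 mul1g.
  by case: base.
case/(translationsP cox)=> i [j ->].
have hT : (tr 1)^-1 * (tr 0)^-1 \in T by rewrite groupM ?groupV ?trT.
have gT : tr 0 ^+ i * tr 1 ^+ j \in T by rewrite groupM ?groupX ?trT.
apply: (rot_differs_cycle hT gT sh4 (mem_cycle _ j)).
rewrite expgMn; last by apply: TC; rewrite groupV trT.
rewrite expgVn !mulgA mulgK.
have /cycleP[m ->] : tr 0 ^+ i * (tr 0)^-1 ^+ j \in <[tr 0]>.
  by rewrite groupM ?groupX ?groupV ?cycle_id.
exact: P0m.
Qed.

Lemma rot_differs_conj k g : rot_differs k g -> rot_differs k (g ^ r).
Proof.
move=> h x; apply/eqP=> e; have /eqP[] := h (r^-1 x).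
apply: (@perm_inj _ r); rewrite -!permM -expgSr expgS mulKg.
by rewrite e conjgE !permM.
Qed.

(** For k = 3 the shifts are the squares of translations, so both exponents can be reduced below 2.
    The half-turns that remain are about a 12-gon, or conjugate to [b * c] and so about a
    quadrilateral. *)
Lemma rot_differs3 g : g \in T -> rot_differs 3 g.
Proof.
have P0 : rot_differs 3 1 by move=> x; rewrite perm1 r_free.
have P1 : rot_differs 3 (tr 0).
  move=> x; rewrite translation0E [X in _ != X]permM; apply/eqP=> /perm_inj/eqP.
  by rewrite eq_sym -(bcC cox) (negPf (bc_free x)).
have P2 : rot_differs 3 (tr 1).
  by rewrite -[1%N]/(0 + 1)%N translationD; apply: rot_differs_conj.
have P3 : rot_differs 3 (tr 2).
  by rewrite -[2]/(1 + 1)%N translationD; apply: rot_differs_conj.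
have sh j g' : g' \in T -> rot_differs 3 (g' * ((tr j)^-1 * (tr j)^-1)) -> rot_differs 3 g'.
  move=> gT h; apply: (rot_differs_tr (j := j + 3) gT).
  by rewrite !trV invgK.
have P12 : rot_differs 3 (tr 0 * tr 1).
  apply: (sh 0); rewrite ?groupM ?trT //.
  rewrite TC ?groupM ?groupV ?trT //.
  by rewrite -!mulgA mulKg -translation2.
have step01 i j : i < 2 -> j < 2 -> rot_differs 3 (tr 0 ^+ i * tr 1 ^+ j).
  by case: i => [|[|]] // _; case: j => [|[|]] // _; rewrite ?expg0 ?expg1 ?mul1g ?mulg1.
have step1 i j : i < 2 -> rot_differs 3 (tr 0 ^+ i * tr 1 ^+ j).
  move=> i2; elim/ltn_ind: j => j IHj; case: (ltnP j 2) => [|j2]; first exact: step01.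
  apply: (sh 1%N); rewrite ?groupM ?groupX ?trT //.
  have -> : tr 1 ^+ j = tr 1 ^+ (j - 2) * tr 1 * tr 1.
    by rewrite -!expgSr -addn2 subnK.
  rewrite !mulgA !mulgK; apply: IHj; by rewrite ltn_subrL (leq_trans _ j2).
case/(translationsP cox)=> i [j ->]; elim/ltn_ind: i => i IHi.
case: (ltnP i 2) => [|i2]; first exact: step1.
apply: (sh 0); rewrite ?groupM ?groupX ?trT //.
have -> : tr 0 ^+ i = tr 0 * tr 0 * tr 0 ^+ (i - 2).
  by rewrite -mulgA -!expgS -addn2 subnK.
rewrite TC ?groupM ?groupV ?groupX ?trT //.
by rewrite -!mulgA !mulKg; apply: IHi; rewrite ltn_subrL (leq_trans _ i2).
Qed.

Lemma rot_differsP k g : g \in T -> 0 < k < 6 -> rot_differs k g.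
Proof.
have inv k' : 0 < k' < 6 -> (forall g, g \in T -> rot_differs (6 - k') g) ->
    forall g, g \in T -> rot_differs k' g.
  move=> k6 h g' gT x; apply/eqP=> e; have /eqP[] := h _ (groupVr gT) (g' x).
  rewrite -{1}e -!permM mulgV -expgD subnKC ?ab6 //.
  by case/andP: k6 => _ /ltnW.
move=> gT; case: k => [|[|[|[|[|[|]]]]]] // _.
- exact: rot_differs1.
- exact: rot_differs2.
- exact: rot_differs3.
- by apply: inv gT => //; apply: rot_differs2.
- by apply: inv gT => //; apply: rot_differs1.
Qed.

End Rigidity.

(** * Walks that alternate between two involutions *)

Section Alternation.

Local Open Scope group_scope.

Variables (V : finType) (o : pred V) (s : V -> V) (g h : {perm V}) (n : nat).

Hypotheses (g2 : g * g = 1) (h2 : h * h = 1).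
Hypothesis sE : forall x, s x = if o x then g x else h x.
Hypothesis so : forall x, o (s x) = ~~ o x.
Hypothesis s_inj : injective s.
Hypothesis s_card : forall x, #|cycle_set s x| = n.*2.

Lemma iter_alt k x :
  iter k.*2 s x = if o x then ((g * h) ^+ k) x else ((h * g) ^+ k) x.
Proof.
elim: k x => [|k IHk] x; first by rewrite !perm1 if_same.
rewrite doubleS -[k.*2.+2]addn2 iterD IHk /= !so negbK !expgS !permM.
by rewrite (sE (s x)) so sE; case: (o x).
Qed.

Lemma alt_expV k : (h * g) ^+ k = ((g * h) ^+ k)^-1.
Proof.
rewrite -expgVn invMg; congr ((_ * _) ^+ _); apply/eqP.
  by rewrite eq_sym eq_invg_mul h2.
by rewrite eq_sym eq_invg_mul g2.
Qed.

Lemma order_alt x : fingraph.order s x = n.*2.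
Proof. by rewrite -(s_card x) cardsE. Qed.

Lemma alt_exp : (g * h) ^+ n = 1.
Proof.
apply/permP=> x; have := iter_order s_inj x; rewrite order_alt iter_alt perm1.
by case: (o x) => // e; apply: (@perm_inj _ ((h * g) ^+ n)); rewrite e alt_expV permK.
Qed.

Lemma alt_free k x : 0 < k < n -> ((g * h) ^+ k) x != x.
Proof.
case/andP=> k0 kn; apply/eqP=> e.
have fix_x : iter k.*2 s x = x.
  rewrite iter_alt; case: (o x) => //.
  by rewrite alt_expV -[in LHS]e permK.
have := @findex_iter _ s x k.*2; rewrite fix_x order_alt ltn_double => /(_ kn).
by rewrite findex0 => /esym/eqP; rewrite double_eq0 -leqn0 leqNgt k0.
Qed.

End Alternation.

(** * Translations and rotations acting on the vertices *)

Section FlagGeometry.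

Local Open Scope group_scope.

Variables (V : finType) (a b c : {perm V}) (o : pred V).
Hypothesis fs : flag_system a b c o.

Local Notation r := (a * b).
Local Notation tr := (translation a b c).
Local Notation T := (translations a b c).

Let aK := flag_aK fs.
Let bK := flag_bK fs.
Let cK := flag_cK fs.
Let oa := flag_oa fs.
Let ob := flag_ob fs.
Let oc := flag_oc fs.

Let a2 : a * a = 1. Proof. by apply/permP=> x; rewrite permM perm1 aK. Qed.
Let b2 : b * b = 1. Proof. by apply/permP=> x; rewrite permM perm1 bK. Qed.
Let c2 : c * c = 1. Proof. by apply/permP=> x; rewrite permM perm1 cK. Qed.

(** The boundary walk of a p-gon alternates between two involutions, so its length p makes the order
    of their product divide p/2; this gives the Coxeter relations. *)
Let alt4 := @alt_exp _ o (side a b c o 4) c b 2 c2 b2 (fun=> erefl)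
  (side_colour fs 4) (@side_inj _ _ _ _ _ fs 4) (fun x => @flag_card _ _ _ _ _ fs 4 x isT).
Let alt6 := @alt_exp _ o (side a b c o 6) a c 3 a2 c2 (fun=> erefl)
  (side_colour fs 6) (@side_inj _ _ _ _ _ fs 6) (fun x => @flag_card _ _ _ _ _ fs 6 x isT).
Let alt12 := @alt_exp _ o (side a b c o 12) b a 6 b2 a2 (fun=> erefl)
  (side_colour fs 12) (@side_inj _ _ _ _ _ fs 12) (fun x => @flag_card _ _ _ _ _ fs 12 x isT).

Lemma flag_coxeter : coxeter_relations a b c.
Proof.
split; split=> //; rewrite ?alt6 //.
  by rewrite (alt_expV c2 b2) alt4 invg1.
by rewrite (alt_expV b2 a2) alt12 invg1.
Qed.

Let cox := flag_coxeter.
Let TC := translationsC cox.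
Let trT := translation_in cox.
Let trV := translation3 cox.

Lemma flag_rot_free k x : 0 < k < 6 -> (r ^+ k) x != x.
Proof.
move=> k6; apply/eqP=> e.
have := @alt_free _ o (side a b c o 12) b a 6 b2 a2 (fun=> erefl)
  (side_colour fs 12) (fun x => @flag_card _ _ _ _ _ fs 12 x isT) k x k6.
by rewrite (alt_expV a2 b2) -{1}e permK eqxx.
Qed.

Lemma flag_rot_differs k g : g \in T -> 0 < k < 6 ->
  forall x, (r ^+ k) x != g x.
Proof.
apply: (rot_differsP cox) => [x|x|j x /andP[j0 j4]].
- rewrite permM; apply: contra_neq (flag_bc_neq fs x) => e.
  by rewrite -[LHS]cK e.
- rewrite permM; apply: contra_neq (flag_ac_neq fs x) => e.
  by rewrite -[LHS]cK e.
- by rewrite flag_rot_free // j0 (leq_trans j4).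
Qed.

(** If [tr 0] fixed y, the vertex opposite to y in its quadrilateral would also be opposite to y in
    its 12-gon, whereas these two faces share only y and [b y]. The other j follow by
    conjugation. *)
Lemma flag_translation_free j x : tr j x != x.
Proof.
rewrite -(add0n j) translationD conjgE !permM; move: ((r ^+ j)^-1 x) (permKV (r ^+ j) x).
move=> y <-; rewrite (inj_eq perm_inj); apply/eqP=> e.
have zy : ((r ^+ 3) y) = b (c y).
  apply: (@perm_inj _ (r ^+ 3)); rewrite -permM -expgD; have [_ [_ _ ->]] := cox.
  by rewrite perm1 -[LHS]e translation0E permM [(c * b) y]permM.
have in4 : b (c y) \in cycle_set (side a b c o 4) y.
  have <- : iter 2 (side a b c o 4) y = b (c y); last exact: cycle_set_iter.
  rewrite /= /side /=; case oy: (o y); rewrite ?ob ?oc oy //=.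
  by rewrite -!permM (bcC cox).
have in12 : b (c y) \in cycle_set (side a b c o 12) y.
  have <- : iter 6 (side a b c o 12) y = b (c y); last exact: cycle_set_iter.
  rewrite -zy -[6]/3.*2 (@iter_alt _ o _ b a _ (side_colour fs 12)) //.
  by rewrite (alt_expV a2 b2) (rot3V cox) if_same.
have /set2P[] : b (c y) \in [set y; b y] by rewrite -(flag_cap4_12 fs) inE in4.
  by move/(congr1 b); rewrite bK => /esym/eqP; rewrite (negPf (flag_bc_neq fs y)).
by move/perm_inj/(congr1 o); rewrite oc; case: (o y).
Qed.

Definition colour_preserving : {set {perm V}} :=
  [set g : {perm V} | [forall x, o (g x) == o x]].

Lemma colour_preservingP (g : {perm V}) :
  reflect (forall x, o (g x) = o x) (g \in colour_preserving).
Proof. by rewrite inE; apply: (iffP eqfunP). Qed.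

Lemma colour_preserving_group : group_set colour_preserving.
Proof.
apply/group_setP; split; first by apply/colour_preservingP=> x; rewrite perm1.
move=> g h /colour_preservingP eg /colour_preservingP eh.
by apply/colour_preservingP=> x; rewrite permM eh eg.
Qed.

Canonical colour_preserving_groupType := Group colour_preserving_group.

Lemma rot_colour : r \in colour_preserving.
Proof. by apply/colour_preservingP=> x; rewrite permM ob oa negbK. Qed.

Lemma translations_colour g x : g \in T -> o (g x) = o x.
Proof.
move=> gT; apply/colour_preservingP: x.
have cb : c * b \in colour_preserving.
  by apply/colour_preservingP=> x; rewrite permM ob oc negbK.
have trj j : tr j \in colour_preserving.
  by rewrite translationE groupJ ?groupX ?rot_colour // groupM ?cb ?groupX ?rot_colour.
by case/(translationsP cox): gT => i [j ->]; rewrite groupM ?groupX ?trj.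
Qed.

(** The elements of the dihedral group of a 12-gon: as e and j < 6 vary, [place e j x] runs over the
    vertices of the 12-gon through x. *)
Definition place (e : bool) (j : nat) : {perm V} := a ^+ e * r ^+ j.

Lemma place_colour e j x : o (place e j x) = e (+) o x.
Proof.
rewrite permM (colour_preservingP _ (groupX j rot_colour)).
by case: e; rewrite ?perm1 ?expg1 ?oa.
Qed.

(** Translations preserve colours, which gives e = e'. If j and j' differed, a nontrivial power of r
    would agree with a translation at some vertex, against [flag_rot_differs]. *)
Lemma place_inj g x e e' j j' : g \in T -> j < 6 -> j' < 6 ->
  place e j x = place e' j' (g x) -> [/\ e = e', j = j' & g x = x].
Proof.
move=> gT j6 j'6 E.
have ee : e = e'.
  have := congr1 o E; rewrite !place_colour translations_colour //.
  by case: (e) (e') (o x) => [] [] [].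
rewrite -{e'}ee in E *.
have key i i' h y : h \in T -> i <= i' -> i' < 6 ->
    place e i y = place e i' (h y) -> i = i'.
  move=> hT ii' i'6 E'; apply/eqP; rewrite eqn_leq ii' leqNgt; apply/negP=> lt.
  have : h ^ (a ^+ e) \in T.
    by case: (e); rewrite ?conjg1 // expg1 (translations_conj_a cox).
  move=> /groupVr/flag_rot_differs -/(_ (i' - i)).
  rewrite subn_gt0 lt (leq_ltn_trans (leq_subr _ _)) // => /(_ isT ((a ^+ e) (h y))).
  rewrite /place -(subnK ii') expgD in E'; move: E'; move: (a ^+ e) (r ^+ i) => A R.
  rewrite !permM => /perm_inj <-; rewrite -conjVg conjgE !permM !permK.
  by rewrite eqxx.
have jj : j = j'.
  case: (leqP j j') => [|/ltnW] le; first exact: key E.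
  apply/esym; apply: (key _ _ g^-1 (g x)) => //; first by rewrite groupV.
  by rewrite permK.
by split=> //; rewrite -jj in E; move/perm_inj: E.
Qed.

End FlagGeometry.

(** * Models *)

Section Model.

Local Open Scope group_scope.

Variables (A : finType) (u : nat -> A -> A).

(* [A] stands for an orbit of translations, [u j] for the action of the j-th  *)
(* shortest translation on it.                                                *)
Definition modelled (V : finType) (a b c : {perm V}) (o : pred V) : Prop :=
  exists g : A -> V,
    [/\ injective g, forall y, o (g y),
        forall j y, j < 6 -> g (u j y) = translation a b c j (g y)
      & forall y y', exists2 t, t \in translations a b c & g y' = t (g y)].

Local Notation flags := (A * bool * 'I_6)%type.

(** A flag (y, e, j) stands for the vertex [place e j (g y)]. The formulas for the three involutions
    come from rewriting [place e j] times a, b or c as a translation followed by another place. *)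
Definition model_a (w : flags) : flags :=
  let: (y, e, j) := w in (y, ~~ e, inord (5 * j %% 6)%N).

Definition model_b (w : flags) : flags :=
  let: (y, e, j) := w in (y, ~~ e, inord ((5 * j + 1) %% 6)%N).

Definition model_c (w : flags) : flags :=
  let: (y, e, j) := w in
  (u ((if e then j + 5 else 5 * j) %% 6)%N y, ~~ e, inord ((5 * j + 4) %% 6)%N).

(** The coding of vertices by flags is injective by [place_inj], and onto because its image is
    closed under a, b, c and the graph is connected. *)
Lemma modelled_bij (V : finType) (a b c : {perm V}) (o : pred V) (y0 : A) :
  flag_system a b c o -> modelled a b c o ->
  exists f : flags -> V,
    [/\ bijective f, forall w, o (f w) = ~~ w.1.2,
        forall w, f (model_a w) = a (f w), forall w, f (model_b w) = b (f w)
      & forall w, f (model_c w) = c (f w)].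
Proof.
move=> fs [g [g_inj g_o g_u g_orb]]; have cox := flag_coxeter fs.
pose f (w : flags) := place a b w.1.2 w.2 (g w.1.1).
have placea e j : place a b e j * a = place a b (~~ e) (5 * j %% 6)%N.
  rewrite /place (rot_exp_mod cox) -mulgA (rot_ref cox) mulgA.
  by case: cox => -[a2 _ _] _; case: e; rewrite ?expg1 ?a2 ?mul1g.
have placeb e j : place a b e j * b = place a b (~~ e) ((5 * j + 1) %% 6)%N.
  have bE : a * (a * b) = b by case: cox => -[a2 _ _] _; rewrite mulgA a2 mul1g.
  transitivity (place a b e j * a * (a * b)); first by rewrite -(mulgA _ a) bE.
  by rewrite placea /place !(rot_exp_mod cox) (expgD _ (5 * j)%N 1) expg1 !mulgA.
have placec e j : place a b e j * c =
    translation a b c ((if e then j + 5 else 5 * j) %% 6)%N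
    * place a b (~~ e) ((5 * j + 4) %% 6)%N.
  have cE : c = translation a b c 0 * ((a * b) ^+ 3 * b).
    rewrite translation0E mulgA -(mulgA (c * b)) -expgD.
    case: cox => -[_ b2 _] [_ _ ->].
    by rewrite mulg1 -mulgA b2 mulg1.
  (* Moving [translation a b c 0] to the left conjugates it by the inverse of the place, which
     changes its index to 5j, or to 5 + 25j, that is j + 5 modulo 6, when the reflection is
     present. *)
  rewrite {1}cE mulgA (conjgCV (place a b e j)) -mulgA; congr (_ * _).
        rewrite (translation_mod cox) /place invMg conjgM (rot_expV cox) -translationD.
    rewrite add0n; case: e; last by rewrite expg0 invg1 conjg1.
    case: (cox) => -[a2 _ _] _; have -> : (a ^+ true)^-1 = a.
      by apply/eqP; rewrite eq_invg_mul a2.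
    rewrite (translation_a cox) -(translation_mod cox).
    rewrite -[RHS](translation_mod cox); congr (translation a b c _).
    by rewrite mulnA addnC -modnDml -modnMml mul1n modnDml ?modn_mod.
  rewrite mulgA /place -(mulgA (a ^+ e)) -expgD -/(place a b e (j + 3)) placeb.
  (* Here 16 is 5 * 3 + 1, from the rotation by 3 and the involution b; it is 4 modulo 6. *)
  by rewrite mulnDr -addnA -(modnDmr _ 16).
have fa w : f (model_a w) = a (f w).
  by case: w => [[y e] j]; rewrite /f /= inordK ?ltn_mod // -permM placea.
have fb w : f (model_b w) = b (f w).
  by case: w => [[y e] j]; rewrite /f /= inordK ?ltn_mod // -permM placeb.
have fc w : f (model_c w) = c (f w).
  case: w => [[y e] j]; rewrite /f /= inordK ?ltn_mod // -permM placec.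
  by rewrite [RHS]permM g_u ?ltn_mod.
have f_inj : injective f.
  move=> [[y e] j] [[y' e'] j']; rewrite /f /= => E.
  have [t tT ey'] := g_orb y y'; rewrite ey' in E.
  have [-> jj tx] := place_inj fs tT (ltn_ord j) (ltn_ord j') E.
  by rewrite (val_inj jj) (g_inj y y') // ey' tx.
have f_surj v : v \in codom f.
  apply: (flag_ind fs (P := fun v => v \in codom f) (x := f (y0, false, ord0))).
    exact: codom_f.
  move=> _ /codomP[w ->]; apply/and3P; split.
  - by rewrite -fa codom_f.
  - by rewrite -fb codom_f.
  - by rewrite -fc codom_f.
exists f; split=> //.
  exists (fun v => iinv (f_surj v)) => [w|v]; last exact: f_iinv.
  by apply: f_inj; rewrite f_iinv.
by move=> [[y e] j]; rewrite /f (place_colour fs) g_o addbT.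
Qed.

Lemma modelled_card (V : finType) (a b c : {perm V}) (o : pred V) (y0 : A) :
  flag_system a b c o -> modelled a b c o -> #|V| = (12 * #|A|)%N.
Proof.
move=> fs mod; have [f [bij_f _ _ _ _]] := modelled_bij y0 fs mod.
by rewrite -(bij_eq_card bij_f) !card_prod card_bool card_ord -mulnA mulnC.
Qed.

Lemma modelled_iso (V : finType) (a b c a' b' c' : {perm V}) (o o' : pred V) (y0 : A) :
  flag_system a b c o -> flag_system a' b' c' o' ->
  modelled a b c o -> modelled a' b' c' o' ->
  exists s : {perm V}, [/\ forall x, s (a x) = a' (s x),
    forall x, s (b x) = b' (s x), forall x, s (c x) = c' (s x)
    & forall x, o' (s x) = o x].
Proof.
move=> fs fs' /(modelled_bij y0 fs)[f [[h fK hK] fo fa fb fc]].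
move=> /(modelled_bij y0 fs')[f' [bij_f' fo' fa' fb' fc']].
have s_inj : injective (f' \o h) := inj_comp (bij_inj bij_f') (can_inj hK).
exists (perm s_inj); split=> x; rewrite !permE /= -{1}(hK x).
- by rewrite -fa fK fa'.
- by rewrite -fb fK fb'.
- by rewrite -fc fK fc'.
- by rewrite hK fo' -{2}(hK x) fo.
Qed.

End Model.

(** * Classification of flag systems *)

(* In the cyclic model of order m + 1 the translations 0 and 1 are 1 and 2.   *)
Definition cyclic_shift (m j : nat) (y : 'I_m.+1) : 'I_m.+1 :=
  inord ((y + nth 0 [:: 1; 2; 1; m; m.-1; m] j) %% m.+1).

(** The translations 0, 1, 2 are the three nonzero elements (1,0), (0,1), (1,1); the indices j and j
    + 3 agree because every element is its own inverse. *)
Definition klein_shift (j : nat) (y : bool * bool) : bool * bool :=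
  (y.1 (+) (j %% 3 != 1), y.2 (+) (j %% 3 != 0)).

Section Classification.

Local Open Scope group_scope.

Variables (V : finType) (a b c : {perm V}) (o : pred V).
Hypothesis fs : flag_system a b c o.

Local Notation r := (a * b).
Local Notation tr := (translation a b c).
Local Notation T := (translations a b c).

Let cox := flag_coxeter fs.
Let trT := translation_in cox.
Let trV := translation3 cox.

Let trC g h x : g \in T -> h \in T -> g (h x) = h (g x).
Proof. by move=> gT hT; rewrite -!permM (translationsC cox gT hT). Qed.

Lemma translation_orbit_card x :
  (12 * #|[set (g : {perm V}) x | g in T]| <= #|V|)%N.
Proof.
set O := [set _ | _ in _]; pose W := setX (setX O [set: bool]) [set: 'I_6].
pose f (w : V * bool * 'I_6) := place a b w.1.2 w.2 w.1.1.
have f_inj : {in W &, injective f}.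
  move=> [[y e] j] [[y' e'] j']; rewrite !in_setX !in_setT !andbT /=.
  case/imsetP=> t tT -> /imsetP[t' t'T ->]; rewrite /f /=.
  have -> : t' x = (t^-1 * t') (t x) by rewrite permM permK.
  by case/(place_inj fs) => //; rewrite ?groupM ?groupV // => -> /val_inj-> ->.
have -> : (12 * #|O|)%N = #|W|.
  by rewrite !cardsX !cardsT card_bool card_ord mulnC -mulnA.
by rewrite -(card_in_imset f_inj) max_card.
Qed.

Lemma small_orbit x (s : seq nat) : #|V| <= 60 ->
  uniq (x :: [seq tr j x | j <- s]) -> size s < 5.
Proof.
move=> V60 us; rewrite -(leq_pmul2l (isT : 0 < 12)%N).
apply: leq_trans V60; apply: leq_trans (translation_orbit_card x).
rewrite leq_pmul2l // cardE -(size_map (fun j => tr j x) s).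
apply: (uniq_leq_size us) => y; rewrite mem_enum inE => /predU1P[->|/mapP[j _ ->]].
  by apply/imsetP; exists 1; rewrite ?perm1.
by apply/imsetP; exists (tr j).
Qed.

Lemma translation_neqS j x : tr j x != tr (j + 1) x.
Proof.
rewrite (translationS cox) permM eq_sym.
exact: (flag_translation_free fs).
Qed.

Lemma perm_exp_mod (t : {perm V}) m i x : (t ^+ m) x = x ->
  (t ^+ (i %% m)) x = (t ^+ i) x.
Proof.
move=> tm; rewrite {2}(divn_eq i m) expgD mulnC expgM permM; congr (_ _).
elim: (i %/ m) => [|q IHq]; first by rewrite perm1.
by rewrite expgS permM tm.
Qed.

(** At x, and hence on its orbit since T is abelian, [tr 2] acts as t = [tr 0] and so [tr 1] as the
    square of t. The orbit is therefore a cycle of t; it has at least three points because neither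
    [tr 0] nor [tr 1] fixes a vertex. *)
Lemma cyclic_model x : o x -> tr 0 x = tr 2 x ->
  exists2 m, 1 < m & modelled (@cyclic_shift m) a b c o.
Proof.
move=> ox e02; set t := tr 0.
have e1 : tr 1 x = (t ^+ 2) x.
  by rewrite (translationS cox 0) permM trC ?trT // -e02 -permM.
have [m em] : exists m, #|porbit t x| = m.+1.
  by exists #|porbit t x|.-1; rewrite prednK // (cardD1 x) porbit_id.
have tm : (t ^+ m.+1) x = x by rewrite permX -em iter_porbit.
have m1 : 1 < m.
  rewrite ltnNge; apply/negP; case: m em tm => [|[|]] // _ tm _.
    by have /eqP[] := flag_translation_free fs 0 x.
  by have /eqP[] := flag_translation_free fs 1 x; rewrite e1.
have tT i : t ^+ i \in T by rewrite groupX ?trT.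
exists m => //; exists (fun y : 'I_m.+1 => (t ^+ y) x); split.
- move=> y y'; rewrite !permX => e; apply/val_inj/eqP => /=.
  rewrite -(nth_uniq x _ _ (uniq_traject_porbit t x)) ?size_traject ?em //.
  by rewrite !nth_traject // e.
- by move=> y; rewrite (translations_colour fs).
- move=> j y j6; rewrite inordK ?ltn_mod // perm_exp_mod // addnC expgD permM.
  rewrite [RHS]trC ?trT //; congr (_ _).
  case: j j6 => [|[|[|[|[|[|]]]]]] //= _.
  + by rewrite (trV 0); apply: (@perm_inj _ t); rewrite permKV -permM -expgSr.
  + rewrite (trV 1); apply: (@perm_inj _ (tr 1)); rewrite permKV trC ?trT // e1.
    by rewrite -permM -expgD add2n prednK // ltnW.
  + rewrite (trV 2); apply: (@perm_inj _ (tr 2)); rewrite permKV trC ?trT // -e02.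
    by rewrite -permM -expgS.
- move=> y y'; exists ((t ^+ y)^-1 * t ^+ y'); first by rewrite groupM ?groupV ?tT.
  by rewrite permM permK.
Qed.

(** The four points of the orbit are distinct because [tr 0], [tr 1] and [tr 2] fix no vertex. *)
Lemma klein_model x : o x -> tr 0 (tr 0 x) = x -> tr 1 (tr 1 x) = x ->
  modelled klein_shift a b c o.
Proof.
move=> ox e0 e1.
pose w (y : bool * bool) : {perm V} := tr 0 ^+ y.1 * tr 1 ^+ y.2.
pose g y := w y x.
have wT y : w y \in T by rewrite groupM ?groupX ?trT.
have g0 p q : tr 0 (g (p, q)) = g (~~ p, q).
  rewrite /g /w /= !permM trC ?groupX ?trT //; congr (_ _).
  by case: p; rewrite ?expg0 ?expg1 ?perm1.
have g1 p q : tr 1 (g (p, q)) = g (p, ~~ q).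
  rewrite /g /w /= !permM; have := trC x (groupX p (trT 0)) (trT 1).
  by case: q; rewrite ?expg0 ?expg1 ?perm1 // => <-; rewrite -trC ?groupX ?trT // e1.
have g2 p q : tr 2 (g (p, q)) = g (~~ p, ~~ q).
  have e : g (p, q) = tr 0 (g (~~ p, q)) by rewrite g0 negbK.
  by rewrite (translation2 cox) [LHS]permM e permK g1.
have free j := flag_translation_free fs j.
exists g; split.
- have n3 p q : g (~~ p, ~~ q) != g (p, q) by rewrite -g2 free.
  have n1 p q : g (~~ p, q) != g (p, q) by rewrite -g0 free.
  have n2 p q : g (p, ~~ q) != g (p, q) by rewrite -g1 free.
  move=> [p q] [p' q'] e; apply/eqP; apply: contraT.
  rewrite xpair_eqE negb_and => h; move: h (n1 p q) (n2 p q) (n3 p q).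
  by rewrite e; case: p p' q q' {e} => [] [] [] [] //=; rewrite eqxx.
- by move=> y; rewrite (translations_colour fs).
- move=> j [p q] j6; rewrite /klein_shift /=.
  have gV i p' q' : tr i (g (p', q')) = g (p, q) -> g (p', q') = tr (i + 3) (g (p, q)).
    by move=> <-; rewrite trV permK.
  case: j j6 => [|[|[|[|[|[|]]]]]] //= _; rewrite ?addbT ?addbF //.
  + exact: gV 0 _ _ (etrans (g0 _ _) (congr1 (fun p => g (p, q)) (negbK p))).
  + by apply: gV 1%N _ _ _; rewrite g1 negbK.
  + by apply: gV 2 _ _ _; rewrite g2 !negbK.
- move=> y y'; exists ((w y)^-1 * w y'); first by rewrite groupM ?groupV.
  by rewrite /g [RHS]permM permK.
Qed.

(** Moving the base point by a rotation renumbers the translations, which reduces a coincidence at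
    any j to one at 0. *)
Lemma translation_rot j x : tr j x = tr (j + 2) x ->
  tr 0 ((r ^+ j)^-1 x) = tr 2 ((r ^+ j)^-1 x).
Proof.
rewrite addnC -{1}(add0n j) !translationD !conjgE !permM.
exact: perm_inj.
Qed.

Lemma flag_classification : 0 < #|V| -> #|V| <= 60 ->
  (exists2 m, 1 < m & modelled (@cyclic_shift m) a b c o) \/
  modelled klein_shift a b c o.
Proof.
move=> V0 V60; have [x ox] : exists x, o x.
  case/card_gt0P: V0 => x _; case ox: (o x); first by exists x.
  by exists (a x); rewrite (flag_oa fs) ox.
have [/existsP[j /eqP ej]|] := boolP [exists j : 'I_6, tr j x == tr (j + 2) x].
  left; apply: (cyclic_model (x := (r ^+ j)^-1 x)); last exact: translation_rot.
  by rewrite (colour_preservingP _ _ _) // groupV groupX ?(rot_colour fs).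
rewrite negb_exists => /forallP n2; right.
have ne2 j : tr j x != tr (j + 2) x.
  have := n2 (inord (j %% 6)); rewrite inordK ?ltn_mod //.
  by rewrite (translation_mod cox) -(translation_mod cox (_ + 2)) modnDml (translation_mod cox).
pose N j := tr j (tr j x) == x.
have N3 j : N (j + 3) = N j.
  rewrite /N trV; apply/eqP/eqP => e; first by rewrite -{1}e !permKV.
  by rewrite -{1}e !permK.
have NV j : tr j x == tr (j + 3) x -> N j.
  by move/eqP=> e; rewrite /N e trV permKV.
have per j : tr (j + 6) = tr j.
  by rewrite -[LHS](translation_mod cox) modnDr (translation_mod cox).
(* Otherwise x and its images under five consecutive translations would be six distinct points of an
   orbit. Indices at distance 1, 2 or 4 always give distinct images here; at distance 3 a
   coincidence would be an instance of N. *)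
have NN j : N j || N (j + 1).
  apply: contraT; rewrite negb_or => /andP[/(contra (NV j)) nj /(contra (NV _)) nj1].
  have d1 i : tr (j + i) x != tr (j + i.+1) x.
    by rewrite -addn1 addnA translation_neqS.
  have d2 i : tr (j + i) x != tr (j + i.+2) x by rewrite -addn2 addnA ne2.
  have d4 : tr j x != tr (j + 4) x.
    by have := ne2 (j + 4); rewrite -addnA per eq_sym.
  have := @small_orbit x [:: j; j + 1; j + 2; j + 3; j + 4] V60.
  rewrite ltnn => -> //=; rewrite !inE !negb_or ![x == _]eq_sym.
  rewrite !(flag_translation_free fs) /= translation_neqS ne2 nj d4 !d1 !d2 /=.
  by rewrite -addnA in nj1; rewrite nj1.
have NS j : N j -> N (j + 2) -> N (j + 1).
  move=> /eqP ej /eqP ej2; rewrite /N (translationS cox) !permM.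
  by rewrite [tr j (tr (j + 2) _)]trC ?trT // ej ej2.
(* N has period 3 and no two neighbouring indices fail, so at most one of N 0, N 1, N 2 fails; [NS]
   then derives it from the other two. *)
have [/eqP n0 /eqP n1] : N 0 /\ N 1%N.
  have := NS 5; rewrite (N3 2) (N3 4) (N3 1%N) (N3 3) (N3 0).
  have := NN 2; rewrite (N3 0); move: (NN 0) (NN 1%N) (NS 0).
  rewrite !add0n; case: (N 0); case: (N 1%N); case: (N 2) => //= _ _ h1 _ h2;
    by [have := h1 isT isT | have := h2 isT isT].
exact: klein_model n1.
Qed.

End Classification.

(** * Isomorphisms *)

Section FlagIsomorphism.

Variable V : finType.

Lemma flag_perms (a b c : V -> V) (o : pred V) : flag_system a b c o ->
  exists a' b' c' : {perm V},
    flag_system a' b' c' o /\ polygons a' b' c' o = polygons a b c o.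
Proof.
move=> fs; have aK := flag_aK fs; have bK := flag_bK fs; have cK := flag_cK fs.
pose a' := perm (inv_inj aK); pose b' := perm (inv_inj bK).
pose c' := perm (inv_inj cK).
have eside p : side a' b' c' o p =1 side a b c o p.
  by move=> x; rewrite /side /a' /b' /c' !permE.
have ecyc p := eq_cycle_set (eside p).
exists a', b', c'; split; last first.
  apply/setP=> A; rewrite !inE; apply: eq_existsb => x.
  by apply: eq_has => p; rewrite ecyc.
split.
- by move=> x; rewrite !permE aK.
- by move=> x; rewrite !permE bK.
- by move=> x; rewrite !permE cK.
- by move=> x; rewrite permE (flag_oa fs).
- by move=> x; rewrite permE (flag_ob fs).
- by move=> x; rewrite permE (flag_oc fs).
- move=> P x Px h; apply: (flag_ind fs Px) => y /h.
  by rewrite !permE.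
- by move=> p x hp; rewrite ecyc (flag_card fs).
- by move=> x; rewrite !ecyc (flag_cap46 fs) permE.
- by move=> x; rewrite !ecyc (flag_cap4_12 fs) permE.
- by move=> x; rewrite !ecyc (flag_cap6_12 fs) permE.
Qed.

Lemma imset_cycle_set (f f' : V -> V) (s : V -> V) x :
  (forall y, s (f y) = f' (s y)) -> s @: cycle_set f x = cycle_set f' (s x).
Proof.
move=> sf; have iterE n : s (iter n f x) = iter n f' (s x).
  by elim: n => //= n <-.
apply/setP=> y; apply/imsetP/idP => [[z]|]; rewrite inE => /iter_findex <-.
  by move=> ->; rewrite iterE inE fconnect_iter.
by exists (iter (findex f' (s x) y) f x); rewrite ?iterE // inE fconnect_iter.
Qed.

Variables (a b c a' b' c' : V -> V) (o o' : pred V) (s : {perm V}).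

Lemma imset_polygons :
  (forall x, s (a x) = a' (s x)) -> (forall x, s (b x) = b' (s x)) ->
  (forall x, s (c x) = c' (s x)) -> (forall x, o' (s x) = o x) ->
  [set s @: A | A : {set V} in polygons a b c o] = polygons a' b' c' o'.
Proof.
move=> sa sb sc so.
have ss p y : s (side a b c o p y) = side a' b' c' o' p (s y).
  by rewrite /side so; do !case: ifP.
apply/setP=> A; apply/imsetP/polygonsP => [[B /polygonsP[p [x [hp ->]]] ->]|].
  by exists p, (s x); rewrite (imset_cycle_set _ (ss p)).
case=> p [x [hp ->]]; exists (cycle_set (side a b c o p) (s^-1%g x)).
  by apply/polygonsP; exists p, (s^-1%g x).
by rewrite (imset_cycle_set _ (ss p)) permKV.
Qed.

Hypotheses (fs : flag_system a b c o) (fs' : flag_system a' b' c' o').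
Hypothesis sP : [set s @: A | A : {set V} in polygons a b c o] = polygons a' b' c' o'.

(** A bijection of vertices preserves the number of vertices of a face, and each vertex lies on just
    one face of each size. *)
Lemma polygons_iso_cycle p x : p \in [:: 4; 6; 12] ->
  s @: cycle_set (side a b c o p) x = cycle_set (side a' b' c' o' p) (s x).
Proof.
move=> hp; have : s @: cycle_set (side a b c o p) x \in polygons a' b' c' o'.
  by rewrite -sP; apply: imset_f; apply/polygonsP; exists p, x.
case/polygonsP=> q [y [hq e]].
have := card_imset (cycle_set (side a b c o p) x) (@perm_inj _ s).
rewrite e (flag_card fs) // (flag_card fs') // => epq; rewrite epq in e.
have : s x \in s @: cycle_set (side a b c o p) x by rewrite imset_f ?cycle_set_refl.
by rewrite e epq => sxy; rewrite (cycle_set_eq (@side_inj _ _ _ _ _ fs' p) sxy).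
Qed.

Lemma polygons_iso_edge p q x y y' : p \in [:: 4; 6; 12] -> q \in [:: 4; 6; 12] ->
  y != x ->
  cycle_set (side a b c o p) x :&: cycle_set (side a b c o q) x = [set x; y] ->
  cycle_set (side a' b' c' o' p) (s x) :&: cycle_set (side a' b' c' o' q) (s x)
    = [set s x; y'] -> s y = y'.
Proof.
move=> hp hq yx e; rewrite -!polygons_iso_cycle // -imsetI; last first.
  by move=> ? ? _ _; apply: perm_inj.
rewrite e => /setP/(_ (s y)); rewrite imset_f ?set22 // => /esym/set2P[] //.
by move/perm_inj=> eyx; rewrite eyx eqxx in yx.
Qed.

(** Each of the three edges at x is the intersection of the two faces of given sizes at x, so an
    isomorphism carries it to the edge of the same kind. *)
Lemma polygons_iso_flag :
  [/\ forall x, s (a x) = a' (s x), forall x, s (b x) = b' (s x)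
    & forall x, s (c x) = c' (s x)].
Proof.
have neq (f : V -> V) : (forall x, o (f x) = ~~ o x) -> forall x, f x != x.
  by move=> of_ x; apply/eqP=> /(congr1 o); rewrite of_; case: (o x).
split=> x.
- apply: (@polygons_iso_edge 6 12 x) => //; first exact: neq (flag_oa fs) _.
    exact: (flag_cap6_12 fs).
  exact: (flag_cap6_12 fs').
- apply: (@polygons_iso_edge 4 12 x) => //; first exact: neq (flag_ob fs) _.
    exact: (flag_cap4_12 fs).
  exact: (flag_cap4_12 fs').
- apply: (@polygons_iso_edge 4 6 x) => //; first exact: neq (flag_oc fs) _.
    exact: (flag_cap46 fs).
  exact: (flag_cap46 fs').
Qed.

End FlagIsomorphism.

Section MapIso.

Variable V : finType.

Lemma map_iso_sym (M M' : rotation V) : map_iso M M' -> map_iso M' M.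
Proof.
case/existsP=> s /eqP e; apply/existsP; exists s^-1%g; rewrite -e -imset_comp.
rewrite (eq_imset (g := id)) ?imset_id // => A /=.
by rewrite -imset_comp (eq_imset (g := id)) ?imset_id // => x /=; rewrite permK.
Qed.

Lemma map_iso_trans (M M' M'' : rotation V) :
  map_iso M M' -> map_iso M' M'' -> map_iso M M''.
Proof.
case/existsP=> s /eqP e /existsP[s' /eqP e']; apply/existsP; exists (s * s')%g.
apply/eqP; rewrite -e' -e -[RHS]imset_comp; apply: eq_imset => A /=.
by rewrite -[RHS]imset_comp; apply: eq_imset => x /=; rewrite permM.
Qed.

Definition map_modelled (A : finType) (u : nat -> A -> A) (M : rotation V) : Prop :=
  exists (a b c : {perm V}) (o : pred V),
    [/\ flag_system a b c o, polygons a b c o = face_vertex_sets M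
      & modelled u a b c o].

Lemma map_modelled_iso (A : finType) (u : nat -> A -> A) (y0 : A) M M' :
  map_modelled u M -> map_modelled u M' -> map_iso M M'.
Proof.
case=> a [b [c [o [fs eM mod]]]] [a' [b' [c' [o' [fs' eM' mod']]]]].
have [s [sa sb sc so]] := modelled_iso y0 fs fs' mod mod'.
by apply/existsP; exists s; rewrite -eM -eM' (imset_polygons sa sb sc so).
Qed.

Lemma map_classification M : M \in maps_4_6_12 V -> #|V| <= 60 ->
  (exists m, [/\ 1 < m, #|V| = 12 * m.+1 & map_modelled (@cyclic_shift m) M]) \/
  (#|V| = 48 /\ map_modelled klein_shift M).
Proof.
rewrite inE => /andP[torM typM] V60.
have V0 : 0 < #|V| by case/and5P: (torM) => _ /andP[].
have [a [b [c [fs ep]]]] := flag_perms (flag_systemM torM typM).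
rewrite (polygonsM torM typM) in ep.
case: (flag_classification fs V0 V60) => [[m m1 mod]|mod]; [left|right].
  exists m; split=> //; last by exists a, b, c; eexists; split; [exact: fs| |].
  by rewrite (modelled_card ord0 fs mod) card_ord.
split; last by exists a, b, c; eexists; split; [exact: fs| |].
by rewrite (modelled_card (true, true) fs mod) card_prod card_bool.
Qed.

End MapIso.

Lemma equivalence_partition0 (T : finType) (R : rel T) :
  equivalence_partition R set0 = set0.
Proof. exact: imset0. Qed.

Lemma equivalence_partition1 (T : finType) (R : rel T) (D : {set T}) x : x \in D ->
  {in D &, forall y z, R y z} -> #|equivalence_partition R D| = 1.
Proof.
move=> xD all_R; apply/eqP/cards1P; exists D; apply/setP=> E.
have cl y : y \in D -> [set z in D | R y z] = D.
  by move=> yD; apply/setP=> z; rewrite inE andb_idr // => zD; apply: all_R.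
apply/imsetP/set1P => [[y yD ->]|->]; first exact: cl.
by exists x; rewrite ?cl.
Qed.

Lemma equivalence_partition2 (T : finType) (R : rel T) (D : {set T}) x y :
  x \in D -> y \in D -> symmetric R -> transitive R ->
  ~~ R x y -> {in D, forall z, R z x || R z y} -> #|equivalence_partition R D| = 2.
Proof.
move=> xD yD symR trR nxy cov.
have cl z w : R z w -> [set t in D | R z t] = [set t in D | R w t].
  move=> zw; apply/setP=> t; rewrite !inE; congr (_ && _).
  by apply/idP/idP; apply: trR; rewrite // symR.
have <- : #|[set [set t in D | R x t]; [set t in D | R y t]]| = 2.
  rewrite cards2; case: eqP => // /setP/(_ y); rewrite !inE yD (negPf nxy) /=.
  have /orP[yx|->] // := cov y yD; by rewrite symR yx in nxy.
apply: eq_card => E; apply/imsetP/set2P => [[z zD ->]|[] ->].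
- by case/orP: (cov z zD) => /cl->; [left|right].
- by exists x.
- by exists y.
Qed.

(** * Flag systems given by tables *)

Section TableSystem.

Variables (m : nat) (a b c : nat -> nat) (o : pred nat).

Local Notation n := m.+1.

Definition table_involution (f : nat -> nat) : bool :=
  all (fun i => [&& f i < n, f (f i) == i & o (f i) == ~~ o i]) (iota 0 n).

Definition table_gon (p i : nat) : seq nat := traject (side a b c o p) i p.

Definition table_gons : bool :=
  all (fun i => all (fun p => uniq (table_gon p i)
                              && (iter p (side a b c o p) i == i))
                    [:: 4; 6; 12]) (iota 0 n).

Definition table_cap (p q : nat) (f : nat -> nat) : bool :=
  all (fun i => let s := table_gon p i in let t := table_gon q i in
    all (fun k => ((k \in s) && (k \in t)) == (k \in [:: i; f i])) (iota 0 n))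
  (iota 0 n).

Definition table_grow (s : seq nat) : seq nat :=
  undup (s ++ map a s ++ map b s ++ map c s).

Definition table_connected : bool :=
  all (mem (iter n table_grow [:: 0])) (iota 0 n).

Definition flag_table : bool :=
  [&& table_involution a, table_involution b, table_involution c, table_gons,
      table_cap 4 6 c, table_cap 4 12 b, table_cap 6 12 a & table_connected].

Definition table_fun (f : nat -> nat) (i : 'I_n) : 'I_n := inord (f i).

(** Turns the conditions on a flag system into tests on natural numbers and lists, which can be
    evaluated, whereas finite sets of ordinals do not compute well. *)
Lemma flag_tableP : flag_table ->
  flag_system (table_fun a) (table_fun b) (table_fun c) (fun i : 'I_n => o i).
Proof.
case/and5P=> inva invb invc gonsP /and4P[cap46 cap4_12 cap6_12 conn].
have iI (i : 'I_n) : (i : nat) \in iota 0 n by rewrite mem_iota ltn_ord.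
have inv f : table_involution f -> forall i : 'I_n,
    [/\ table_fun f i = f i :> nat, table_fun f (table_fun f i) = i
      & o (table_fun f i) = ~~ o i].
  move=> /allP h i; have /and3P[lt /eqP fK /eqP fo] := h _ (iI i).
  have e : table_fun f i = f i :> nat by rewrite inordK.
  by split=> //; [apply/ord_inj; rewrite {1}/table_fun e inordK fK|rewrite e].
have va i : table_fun a i = a i :> nat by case: (inv a inva i).
have vb i : table_fun b i = b i :> nat by case: (inv b invb i).
have vc i : table_fun c i = c i :> nat by case: (inv c invc i).
pose sd := side (table_fun a) (table_fun b) (table_fun c) (fun i : 'I_n => o i).
have vsd p i : sd p i = side a b c o p i :> nat.
  by rewrite /sd /side; do !case: ifP.
have viter k p i : iter k (sd p) i = iter k (side a b c o p) i :> nat.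
  by elim: k => //= k IHk; rewrite vsd IHk.
have map_val p i : map (@nat_of_ord n) (traject (sd p) i p) = table_gon p i.
  apply: (@eq_from_nth _ 0) => [|k]; rewrite size_map !size_traject // => kp.
  rewrite /table_gon (nth_map i) ?size_traject // nth_traject // viter.
  by rewrite (set_nth_default (i : nat)) ?size_traject // nth_traject.
have cyc p i : p \in [:: 4; 6; 12] ->
    uniq (traject (sd p) i p) /\ cycle_set (sd p) i = [set k in traject (sd p) i p].
  move=> hp; have /andP[un /eqP it] := allP (allP gonsP _ (iI i)) p hp.
  split; first by rewrite -(map_inj_uniq (@ord_inj n)) map_val.
  apply/setP=> k; rewrite !inE; apply: fconnect_cycle; last first.
    by move: hp; rewrite !inE => /or3P[] /eqP->; rewrite trajectS mem_head.
  have itE : iter p (sd p) i = i by apply/ord_inj; rewrite viter.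
  have : 0 < p by move: hp; rewrite !inE => /or3P[] /eqP->.
  move: (sd p) itE => f; case: p {hp un it} => // p itE _.
  by rewrite trajectS /= rcons_path fpath_traject last_traject /= -iterS itE.
have mem_gon p i k : p \in [:: 4; 6; 12] ->
    (k \in cycle_set (sd p) i) = ((k : nat) \in table_gon p i).
  by move=> hp; have [_ ->] := cyc p i hp; rewrite inE -map_val (mem_map (@ord_inj n)).
have cap p q f i : table_involution f -> p \in [:: 4; 6; 12] -> q \in [:: 4; 6; 12] ->
    table_cap p q f -> cycle_set (sd p) i :&: cycle_set (sd q) i = [set i; table_fun f i].
  move=> invf hp hq /allP capf; apply/setP=> k; rewrite in_setI !mem_gon // in_set2.
  have /eqP -> := allP (capf _ (iI i)) k (iI k).
  by rewrite !inE -!(inj_eq (@ord_inj n)); case: (inv f invf i) => ->.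
split; try by move=> i; case: (inv _ inva i) => //; case: (inv _ invb i) => //;
  case: (inv _ invc i).
- move=> P x Px closP y.
  have eP f : table_involution f -> (forall z, P z -> P (table_fun f z)) ->
      forall z, P (table_fun f z) = P z.
    move=> invf Pf z; apply/idP/idP; last exact: Pf.
    by move/Pf; case: (inv f invf z) => _ ->.
  have ea : forall z, P (table_fun a z) = P z.
    by apply: eP => // z /closP/and3P[].
  have eb : forall z, P (table_fun b z) = P z.
    by apply: eP => // z /closP/and3P[].
  have ec : forall z, P (table_fun c z) = P z.
    by apply: eP => // z /closP/and3P[].
  (* A predicate closed under the three involutions is invariant under them, hence constant on all
     that is reached from 0. *)
  have grow k i : i \in iter k (table_grow) [:: 0] ->
      exists2 z : 'I_n, z = i :> nat & P z = P ord0.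
    elim: k i => [|k IHk] i /=.
      by rewrite inE => /eqP->; exists ord0.
    rewrite mem_undup !mem_cat => /or4P[/IHk //|||] /mapP[i' /IHk[z <- <-] ->].
    - by exists (table_fun a z).
    - by exists (table_fun b z).
    - by exists (table_fun c z).
  have all0 (z : 'I_n) : P z = P ord0.
    by have [z' /ord_inj-> ->] := grow _ _ (allP conn _ (iI z)).
  by rewrite all0 -(all0 x).
- by move=> p i hp; case: (cyc p i hp) => un ->; rewrite cardsE (card_uniqP un) size_traject.
- by move=> i; apply: cap.
- by move=> i; apply: cap.
- by move=> i; apply: cap.
Qed.

End TableSystem.

(* The flag (y, e, j) of a model is coded as 12 y + 6 e + j; [u j] translates *)
(* the codes y.                                                               *)
Definition code_flag (y : nat) (e : bool) (j : nat) : nat := 12 * y + 6 * e + j %% 6.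

Definition code_a (i : nat) : nat :=
  code_flag (i %/ 12) (~~ odd (i %/ 6)) (5 * (i %% 6)).

Definition code_b (i : nat) : nat :=
  code_flag (i %/ 12) (~~ odd (i %/ 6)) (5 * (i %% 6) + 1).

Definition code_c (u : nat -> nat -> nat) (i : nat) : nat :=
  code_flag (u ((if odd (i %/ 6) then i %% 6 + 5 else 5 * (i %% 6)) %% 6) (i %/ 12))
            (~~ odd (i %/ 6)) (5 * (i %% 6) + 4).

Definition code_colour (i : nat) : bool := ~~ odd (i %/ 6).

Definition code_cyclic (k j y : nat) : nat :=
  (y + nth 0 [:: 1; 2; 1; k.-1; k.-2; k.-1] j) %% k.

(* The Klein group is coded in binary. *)
Definition code_klein (j y : nat) : nat :=
  nth 0 (nth [::] [:: [:: 1; 0; 3; 2]; [:: 2; 3; 0; 1]; [:: 3; 2; 1; 0]] (j %% 3)) y.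

Definition table_map (m : nat) (u : nat -> nat -> nat) : rotation 'I_m.+1 :=
  flag_map (table_fun code_a) (table_fun code_b) (table_fun (code_c u))
           (fun i : 'I_m.+1 => code_colour i).

Lemma table_map_in m u : flag_table m code_a code_b (code_c u) code_colour ->
  table_map m u \in maps_4_6_12 'I_m.+1.
Proof.
move=> /flag_tableP fs; rewrite inE.
by rewrite (flag_map_torus fs) ?card_ord // (flag_map_type fs).
Qed.

Lemma flag_table36 : flag_table 35 code_a code_b (code_c (code_cyclic 3)) code_colour.
Proof. by vm_compute. Qed.

Lemma flag_table48 : flag_table 47 code_a code_b (code_c (code_cyclic 4)) code_colour.
Proof. by vm_compute. Qed.

Lemma flag_table48k : flag_table 47 code_a code_b (code_c code_klein) code_colour.
Proof. by vm_compute. Qed.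

Lemma flag_table60 : flag_table 59 code_a code_b (code_c (code_cyclic 5)) code_colour.
Proof. by vm_compute. Qed.

(** * Telling the two maps with 48 vertices apart *)

Definition translate (T : Type) (a b c : T -> T) (x : T) : T :=
  iter 3 (b \o a) (b (c x)).

(** [translate] is the translation 0, [c * b * r ^+ 3], for plain functions; products of
    permutations act from left to right. Its values on ordinals are thus computed on natural
    numbers. *)
Lemma table_translate m f x : flag_table m code_a code_b (code_c f) code_colour ->
  translate (@table_fun m code_a) (table_fun code_b) (table_fun (code_c f)) x
  = translate code_a code_b (code_c f) x :> nat.
Proof.
case/and5P=> inva invb invc _ _; rewrite /translate.
have val_fun g (i : 'I_m.+1) : table_involution m code_colour g ->
    table_fun g i = g i :> nat.
  move=> /allP /(_ i); rewrite mem_iota ltn_ord => /(_ isT) /and3P[lt _ _].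
  by rewrite inordK.
by do !rewrite /= val_fun //.
Qed.

Lemma klein_square :
  all (fun i => translate code_a code_b (code_c code_klein)
    (translate code_a code_b (code_c code_klein) i) == i) (iota 0 48).
Proof. by vm_compute. Qed.

Lemma cyclic_square :
  translate code_a code_b (code_c (code_cyclic 4))
    (translate code_a code_b (code_c (code_cyclic 4)) 0) != 0.
Proof. by vm_compute. Qed.

(* In the Klein model the square of a translation is the identity, in the     *)
(* cyclic model of order 4 it is not.                                         *)
Lemma table_map48_not_iso :
  ~~ map_iso (table_map 47 (code_cyclic 4)) (table_map 47 code_klein).
Proof.
apply/existsP=> -[s /eqP]; have fs := flag_tableP flag_table48.
have fs' := flag_tableP flag_table48k; rewrite !flag_map_polygons // => sP.
have [sa sb sc] := polygons_iso_flag fs fs' sP.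
set t := translate (@table_fun 47 code_a) (table_fun code_b) (table_fun (code_c (code_cyclic 4))).
set t' := translate (@table_fun 47 code_a) (table_fun code_b) (table_fun (code_c code_klein)).
have st x : s (t x) = t' (s x) by rewrite /t /t' /translate /= !(sa, sb, sc).
have t'2 x : t' (t' x) = x.
  apply/ord_inj; rewrite /t' !(table_translate _ flag_table48k).
  by apply/eqP; apply: (allP klein_square) (x : nat) _; rewrite mem_iota ltn_ord.
have /(congr1 (@nat_of_ord 48)) : t (t ord0) = ord0.
  by apply: (@perm_inj _ s); rewrite !st t'2.
rewrite /t !(table_translate _ flag_table48).
exact/eqP/cyclic_square.
Qed.

(** * Counting the isomorphism classes *)

Lemma maps_cyclic n m (M : rotation 'I_n) : n <= 60 -> n <> 48 -> n = 12 * m.+1 ->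
  M \in maps_4_6_12 'I_n -> map_modelled (@cyclic_shift m) M.
Proof.
move=> n60 n48 en /map_classification; rewrite card_ord => /(_ n60).
case=> [[k [_ ek mod]]|[]] //; suff -> : m = k by [].
by apply/eqP; rewrite -eqSS -(eqn_pmul2l (isT : 0 < 12)) -en -ek.
Qed.

Lemma num_maps_cyclic n m (M : rotation 'I_n) : n <= 60 -> n <> 48 ->
  n = 12 * m.+1 -> M \in maps_4_6_12 'I_n -> num_maps_4_6_12 n = 1.
Proof.
move=> n60 n48 en MD; apply: (equivalence_partition1 MD) => M1 M2 D1 D2.
by apply: (map_modelled_iso (ord0 : 'I_m.+1)); apply: maps_cyclic.
Qed.

Theorem theorem4p8 :
  [/\ num_maps_4_6_12 36 = 1,
      num_maps_4_6_12 48 = 2,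
      num_maps_4_6_12 60 = 1 &
      forall n : nat, n <= 60 -> n \notin [:: 36; 48; 60] ->
        num_maps_4_6_12 n = 0].
Proof.
split.
- exact: (@num_maps_cyclic 36 2 _ _ _ _ (table_map_in flag_table36)).
- pose M1 := table_map 47 (code_cyclic 4); pose M2 := table_map 47 code_klein.
  have D1 : M1 \in maps_4_6_12 'I_48 := table_map_in flag_table48.
  have D2 : M2 \in maps_4_6_12 'I_48 := table_map_in flag_table48k.
  have n12 : ~~ map_iso M1 M2 := table_map48_not_iso.
  apply: (equivalence_partition2 D1 D2) => //.
  + by move=> M M'; apply/idP/idP; apply: map_iso_sym.
  + by move=> M M' M''; apply: map_iso_trans.
  have dich M : M \in maps_4_6_12 'I_48 ->
      map_modelled (@cyclic_shift 3) M \/ map_modelled klein_shift M.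
    move/map_classification; rewrite card_ord => /(_ isT).
    case=> [[m [_ em mod]]|[_ mod]]; [left|by right].
    have e3 : m = 3 by apply/eqP; rewrite -eqSS -(eqn_pmul2l (isT : 0 < 12)) -em.
    by rewrite e3 in mod.
  have cyc := map_modelled_iso (ord0 : 'I_4); have kln := map_modelled_iso (true, true).
  (* M1 and M2 are not isomorphic, so they follow different models and between them cover both;
     which table follows which model does not have to be computed. *)
  move=> M /dich hM; case: (dich M1 D1) (dich M2 D2) => h1 [] h2.
  + by rewrite (cyc _ _ _ _ h1 h2) in n12.
  + by case: hM => h; [rewrite (cyc _ _ _ _ h h1)|rewrite (kln _ _ _ _ h h2) orbT].
  + by case: hM => h; [rewrite (cyc _ _ _ _ h h2) orbT|rewrite (kln _ _ _ _ h h1)].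
  + by rewrite (kln _ _ _ _ h1 h2) in n12.
- exact: (@num_maps_cyclic 60 4 _ _ _ _ (table_map_in flag_table60)).
move=> n n60 nn; rewrite /num_maps_4_6_12 (_ : maps_4_6_12 _ = set0).
  by rewrite equivalence_partition0 cards0.
apply/setP=> M; rewrite in_set0; apply/negP => /map_classification.
rewrite card_ord => /(_ n60); case=> [[m [m1 en _]]|[en _]]; move: nn; rewrite en //.
(* Together with 1 < m this leaves m = 2, 3, 4, that is n = 36, 48, 60. *)
have m5 : m.+1 <= 5 by rewrite -(leq_pmul2l (isT : 0 < 12)) -en.
by case: m m1 m5 {en} => [|[|[|[|[|m]]]]].
Qed.
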